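(* Let $\mathcal M$ be a 4-dimensional real oriented manifold with a real Lorentzian Weyl geometry $(g,A)$, and let $\mathcal P$ be its Penrose twistor bundle with the natural 1-forms $E_L,F_L,\Lambda_L$. The Weyl geometry satisfies the Einstein-Weyl equations if the forms $(E_L,\bar F_L,\Lambda_L)$ satisfy the invariant equation $$dE_L\wedge\bar F_L\wedge\Lambda_L\wedge E_L=0$$ everywhere on $\mathcal P$.
   Context: Weyl geometry. A real Lorentzian Weyl geometry $(g,A)$ consists of a real Lorentzian metric $g$ and a real 1-form $A$ on $\mathcal M$. In a coframe $(\theta^i)$ of complex-valued 1-forms, $g=g_{ij}\theta^i\theta^j$, the Weyl connection 1-forms $\Gamma^i_{\ j}$ are uniquely determined by $dg_{ij}-g_{ik}\Gamma^k_{\ j}-g_{jk}\Gamma^k_{\ i}=-A\,g_{ij}$ and $d\theta^i=-\Gamma^i_{\ j}\wedge\theta^j$. Curvature: $\frac12R_{ijkl}\theta^k\wedge\theta^l=g_{ih}(d\Gamma^h_{\ j}+\Gamma^h_{\ k}\wedge\Gamma^k_{\ j})$, $R_{jl}=g^{ik}R_{ijkl}$, $R=g^{ij}R_{ij}$, $S_{ij}=R_{(ij)}-\frac14Rg_{ij}$. The Einstein-Weyl equations are $S_{ij}=0$. A null cotetrad is a complex coframe $(\theta^1,\dots,\theta^4)=(M,P,N,K)$ with $g=MP-NK$, where $\alpha\beta=\frac12(\alpha\otimes\beta+\beta\otimes\alpha)$, $\bar M=P$, $N,K$ real, and compatible with the orientation in the sense that the volume form is $\eta=M\wedge P\wedge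 N\wedge K$. The dual frame is $(m,p,n,k)$. Twistor bundle. $\mathcal P$ is the $S^2$-bundle $\pi:\mathcal P\to\mathcal M$ of self-dual totally null 2-planes $\mathrm{Span}\{zm-k,zn-p\}\subset T_x\mathcal M^{\mathbb C}$, $z\in\mathbb C\cup\{\infty\}$, naturally identified with the bundle of real null directions spanned by $k-zm-\bar zp+z\bar zn$. Local coordinates are $(x,z,\bar z)$. On $\mathcal P$ (pullbacks not written) $$E_L=dz-\Gamma^3_{\ 2}+z(\Gamma^1_{\ 1}-\Gamma^4_{\ 4})+z^2\Gamma^2_{\ 3},\quad \Lambda_L=-N-z\bar zK-zP-\bar zM,\quad F_L=M+zK.$$ Intrinsically these forms are given up to $\Lambda_L\to u\Lambda_L$ ($u$ real nonvanishing), $E_L\to hE_L$ ($h$ complex nonvanishing), $F_L\to e^{i\phi}F_L+p\Lambda_L$ ($\phi$ real, $p$ complex functions); the equation is invariant under these changes. Standing assumption: $\mathcal M$ is such that $E_L$ can be chosen globally (e.g. an open subset of $\mathbb R^4$). *)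

(* Defs.v *)
From HB Require Import structures.
From mathcomp Require Import all_boot all_order all_algebra all_fingroup.
From mathcomp Require Import all_classical all_reals all_analysis.
From mathcomp Require Import complex.

Set Implicit Arguments.
Unset Strict Implicit.
Unset Printing Implicit Defensive.

Import Order.TTheory GRing.Theory Num.Theory.
Import numFieldNormedType.Exports.

Local Open Scope classical_set_scope.
Local Open Scope ring_scope.
Local Open Scope complex_scope.

(** * Smooth maps between open subsets of normed spaces *)

Section Smooth.
Context {R : realType} {V W : normedModType R}.

(* For k = oo this is the usual notion; at finite k it is slightly more than
   C^k, differentiability being required at every step. *)
Fixpoint Ck_on (k : nat) (U : set V) (f : V -> W) : Prop :=
  match k with
  | 0 => forall x, U x -> {for x, continuous f}
  | k'.+1 => (forall x, U x -> differentiable f x) /\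
             (forall v, Ck_on k' U (fun x => 'D_v f x))
  end.

Definition smooth_on (U : set V) (f : V -> W) := forall k, Ck_on k U f.

End Smooth.

Definition complex_smooth_on {R : realType} {m n : nat} {V : normedModType R}
    (U : set V) (f : V -> 'M[R[i]]_(m.+1, n.+1)) :=
  smooth_on U (fun x => map_mx (@complex.Re R) (f x) : 'M[R]_(m.+1, n.+1)) /\
  smooth_on U (fun x => map_mx (@complex.Im R) (f x) : 'M[R]_(m.+1, n.+1)).

(** * Complex-valued differential forms on a real normed space *)

Section Forms.
Context {R : realType} {V : normedModType R}.

Definition cderive (f : V -> R[i]) (x v : V) : R[i] :=
  ('D_v (fun y => complex.Re (f y)) x) +i* ('D_v (fun y => complex.Im (f y)) x).

Definition form (k : nat) := V -> ('I_k -> V) -> R[i].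

(* The Lie bracket terms of the invariant formula are absent because the
   arguments v are constant vector fields. *)
Definition ext_d {k} (w : form k) : form k.+1 := fun x v =>
  \sum_(i < k.+1)
     (-1) ^+ i * cderive (fun y => w y (fun j => v (lift i j))) x (v i).

(* Normalised so that (a /\ b)(u, v) = a(u) b(v) - a(v) b(u) on 1-forms, in
   agreement with [ext_d]. *)
Definition wedge {k l} (a : form k) (b : form l) : form (k + l) := fun x v =>
  ((k`! * l`!)%N%:R)^-1 *
  \sum_(s : 'S_(k + l))
     (-1) ^+ s * (a x (fun i => v (s (lshift l i))) *
                  b x (fun j => v (s (rshift k j)))).

Definition form_conj {k} (a : form k) : form k := fun x v => conjc (a x v).

End Forms.
Arguments form {R} V k.

Notation "a '/w\' b" := (wedge a b) (at level 40, left associativity).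

Definition form_of_row {R : realType} (a : 'rV[R]_4 -> 'rV[R[i]]_4) :
    form 'rV[R]_4 1 :=
  fun x v => \sum_(c < 4) a x 0 c * (v 0 0 c)%:C.

Definition complexify {R : realType} {m n} (B : 'M[R]_(m, n)) : 'M[R[i]]_(m, n) :=
  map_mx (fun t : R => t%:C) B.

(* The labels 1, 2, 3, 4 of a coframe. *)
Definition i1 : 'I_4 := @Ordinal 4 0 isT.
Definition i2 : 'I_4 := @Ordinal 4 1 isT.
Definition i3 : 'I_4 := @Ordinal 4 2 isT.
Definition i4 : 'I_4 := @Ordinal 4 3 isT.

(** * Weyl connection and curvature in a complex coframe

    On an open set of R^4, [G x] is the matrix of a metric and [A x] the row of
    components of a real 1-form; row [i] of [T x] holds the components of
    theta^i, and [Gam i j] those of Gamma^i_j. *)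

Section Coframe.
Context {R : realType}.
Variables (G : 'rV[R]_4 -> 'M[R]_4) (A : 'rV[R]_4 -> 'rV[R]_4).
Variables (T : 'rV[R]_4 -> 'M[R[i]]_4)
          (Gam : 'I_4 -> 'I_4 -> 'rV[R]_4 -> 'rV[R[i]]_4).

Definition coframe_on (U : set 'rV[R]_4) :=
  [/\ open U, complex_smooth_on U T & forall x, U x -> T x \in unitmx].

Definition theta (i : 'I_4) : form 'rV[R]_4 1 := form_of_row (fun x => row i (T x)).

(* The j-th vector of the frame dual to (theta^i). *)
Definition dual_vec (x : 'rV[R]_4) (j : 'I_4) : 'rV[R[i]]_4 :=
  (col j (invmx (T x)))^T.

(* g = g_ij theta^i theta^j *)
Definition frame_metric (x : 'rV[R]_4) : 'M[R[i]]_4 :=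
  (invmx (T x))^T *m complexify (G x) *m invmx (T x).

Definition weyl_connection_on (U : set 'rV[R]_4) :=
  [/\ forall i j, complex_smooth_on U (Gam i j),
      forall x, U x -> forall i j v,
        ext_d (fun (y : 'rV[R]_4) (_ : 'I_0 -> 'rV[R]_4) => frame_metric y i j) x v
          - \sum_k frame_metric x i k * form_of_row (Gam k j) x v
          - \sum_k frame_metric x j k * form_of_row (Gam k i) x v
        = - (form_of_row (fun y => complexify (A y)) x v * frame_metric x i j)
    & forall x, U x -> forall i v,
        ext_d (theta i) x v = - \sum_j (form_of_row (Gam i j) /w\ theta j) x v].

Definition curvature_form (i j : 'I_4) : form 'rV[R]_4 2 := fun x v =>
  \sum_h frame_metric x i h *
    (ext_d (form_of_row (Gam h j)) x v +
     \sum_k (form_of_row (Gam h k) /w\ form_of_row (Gam k j)) x v).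

(* The R_ijkl, antisymmetric in k, l, with
   curvature_form i j = 1/2 R_ijkl theta^k /\ theta^l : the value of the
   complex-bilinear extension of the 2-form on the dual frame. *)
Definition riemann (x : 'rV[R]_4) (i j k l : 'I_4) : R[i] :=
  \sum_(a < 4) \sum_(b < 4) dual_vec x k 0 a * dual_vec x l 0 b *
    curvature_form i j x (fun s : 'I_2 => delta_mx 0 (if s == 0 then a else b)).

Definition ricci (x : 'rV[R]_4) (j l : 'I_4) : R[i] :=
  \sum_i \sum_k invmx (frame_metric x) i k * riemann x i j k l.

Definition scalar_curv (x : 'rV[R]_4) : R[i] :=
  \sum_i \sum_j invmx (frame_metric x) i j * ricci x i j.

Definition tracefree_ricci (x : 'rV[R]_4) (i j : 'I_4) : R[i] :=
  2^-1 * (ricci x i j + ricci x j i) - 4^-1 * scalar_curv x * frame_metric x i j.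

End Coframe.

(** * Null cotetrads *)

(* The rows of [T] are M, P, N, K. As M is conjugate to P, the form
   M /\ P /\ N /\ K = \det T dx^1..dx^4 is imaginary; compatibility with the
   orientation is read as positivity of i M /\ P /\ N /\ K, which for
   M = e1 + i e2, N = e3 + e4, K = e4 - e3 is 4 e1 /\ e2 /\ e3 /\ e4.  The
   opposite choice amounts to reversing the orientation. *)
Definition null_cotetrad {R : realType} (G : 'M[R]_4) (T : 'M[R[i]]_4) : Prop :=
  [/\ forall a, conjc (T i1 a) = T i2 a,
      forall a, complex.Im (T i3 a) = 0 /\ complex.Im (T i4 a) = 0,
      forall a b, (G a b)%:C =
        2^-1 * (T i1 a * T i2 b + T i2 a * T i1 b) -
        2^-1 * (T i3 a * T i4 b + T i4 a * T i3 b)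
    & 0 < (0 +i* 1) * \det T].

(* Span {zm - k, zn - p}, with [None] standing for z = oo. *)
Definition twistor_plane {R : realType} (T : 'M[R[i]]_4) (z : option R[i]) :
    {vspace 'rV[R[i]]_4} :=
  let e j := (col j (invmx T))^T in
  let m := e i1 in let p := e i2 in let n := e i3 in let k := e i4 in
  match z with
  | Some z => <<[:: z *: m - k; z *: n - p]>>%VS
  | None => <<[:: m; n]>>%VS
  end.

(* The fibre of the twistor bundle: the self-dual totally null 2-planes. *)
Definition twistor_fiber {R : realType} (G : 'M[R]_4) : set {vspace 'rV[R[i]]_4} :=
  [set W | exists T z, null_cotetrad G T /\ W = twistor_plane T z].

(** * The forms E_L, F_L, Lambda_L, in the coordinates (x, (Re z, Im z)) *)

Section TwistorForms.
Context {R : realType}.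

Definition twistor_space : normedModType R := ('rV[R]_4 * (R^o * R^o))%type.

Definition zcoord (q : twistor_space) : R[i] := q.2.1 +i* q.2.2.

Definition twistor_pt (x : 'rV[R]_4) (z : R[i]) : twistor_space :=
  (x, (complex.Re z, complex.Im z)).

Definition pullback {k} (a : form 'rV[R]_4 k) : form twistor_space k :=
  fun q v => a q.1 (fun i => (v i).1).

Variables (T : 'rV[R]_4 -> 'M[R[i]]_4)
          (Gam : 'I_4 -> 'I_4 -> 'rV[R]_4 -> 'rV[R[i]]_4).

Let M := pullback (theta T i1).
Let P := pullback (theta T i2).
Let N := pullback (theta T i3).
Let K := pullback (theta T i4).
Let Gm i j := pullback (form_of_row (Gam i j)).

Definition E_L : form twistor_space 1 := fun q v =>
  let z := zcoord q in
  ext_d (fun (q' : twistor_space) (_ : 'I_0 -> twistor_space) => zcoord q') q v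
  - Gm i3 i2 q v + z * (Gm i1 i1 q v - Gm i4 i4 q v) + z ^+ 2 * Gm i2 i3 q v.

Definition Lambda_L : form twistor_space 1 := fun q v =>
  let z := zcoord q in
  - N q v - z * conjc z * K q v - z * P q v - conjc z * M q v.

Definition F_L : form twistor_space 1 := fun q v => M q v + zcoord q * K q v.

Definition invariant_form : form twistor_space 5 :=
  ext_d E_L /w\ form_conj F_L /w\ Lambda_L /w\ E_L.

End TwistorForms.

(** * Oriented 4-manifolds and Weyl geometries *)

Record oriented_manifold4 (R : realType) := OrientedManifold4 {
  pt :> topologicalType;
  chart_index : Type;
  chart_dom : chart_index -> set pt;
  chart : chart_index -> pt -> 'rV[R]_4;
  chart_inv : chart_index -> 'rV[R]_4 -> pt;
  manifold_hausdorff : hausdorff_space pt;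
  manifold_countable : @second_countable pt;
  chart_cover : forall x, exists i, chart_dom i x;
  chart_dom_open : forall i, open (chart_dom i);
  chart_image_open : forall i, open (chart i @` chart_dom i);
  chartK : forall i x, chart_dom i x -> chart_inv i (chart i x) = x;
  chart_continuous : forall i x, chart_dom i x -> {for x, continuous (chart i)};
  chart_inv_continuous : forall i x, chart_dom i x ->
    {for chart i x, continuous (chart_inv i)};
  transition_smooth : forall i j,
    smooth_on (chart i @` (chart_dom i `&` chart_dom j)) (chart j \o chart_inv i);
  transition_oriented : forall i j x, chart_dom i x -> chart_dom j x ->
    0 < \det (jacobian (chart j \o chart_inv i) (chart i x))
}.

(* Signature (+, +, +, -), that of MP - NK. *)
Definition lorentzian {R : realType} (G : 'M[R]_4) : Prop :=
  exists2 B : 'M[R]_4, B \in unitmx &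
    G = B^T *m diag_mx (\row_i (if i == i4 then -1 else 1)) *m B.

(* Tensor fields are given by their components in every chart. With the row
   convention of [jacobian], entry (a, b) is the derivative of the b-th new
   coordinate along the a-th old one. *)
Record weyl_geometry (R : realType) (X : oriented_manifold4 R) := WeylGeometry {
  metric : chart_index X -> 'rV[R]_4 -> 'M[R]_4;
  weyl_form : chart_index X -> 'rV[R]_4 -> 'rV[R]_4;
  metric_smooth : forall i, smooth_on (chart i @` chart_dom i) (metric i);
  weyl_form_smooth : forall i, smooth_on (chart i @` chart_dom i) (weyl_form i);
  metric_lorentzian : forall i (x : X), chart_dom i x ->
    lorentzian (metric i (chart i x));
  metric_change : forall i j (x : X), chart_dom i x -> chart_dom j x ->
    let J := jacobian (chart j \o chart_inv i) (chart i x) in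
    metric i (chart i x) = J *m metric j (chart j x) *m J^T;
  weyl_form_change : forall i j (x : X), chart_dom i x -> chart_dom j x ->
    let J := jacobian (chart j \o chart_inv i) (chart i x) in
    weyl_form i (chart i x) = weyl_form j (chart j x) *m J^T
}.

(* S_ij = 0 in every local coframe. *)
Definition einstein_weyl (R : realType) (X : oriented_manifold4 R)
    (w : weyl_geometry X) : Prop :=
  forall (c : chart_index X) (U : set 'rV[R]_4) T Gam,
    U `<=` chart c @` chart_dom c ->
    coframe_on T U ->
    weyl_connection_on (metric w c) (weyl_form w c) T Gam U ->
    forall x, U x -> forall i j, tracefree_ricci (metric w c) T Gam x i j = 0.

(* [y] and [W] are the representatives, in the chart [c], of a point of the
   twistor bundle. Near it E_L, F_L, Lambda_L are the forms of some local null
   cotetrad in which [W] has a finite coordinate z; which one is immaterial,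
   since changing it changes the forms by the rescalings under which the
   equation is invariant. *)
Definition invariant_equation_at (R : realType) (X : oriented_manifold4 R)
    (w : weyl_geometry X) (c : chart_index X) (y : 'rV[R]_4)
    (W : {vspace 'rV[R[i]]_4}) : Prop :=
  exists (U : set 'rV[R]_4) T Gam z,
    [/\ U y /\ U `<=` chart c @` chart_dom c,
        coframe_on T U /\ (forall x, U x -> null_cotetrad (metric w c x) (T x)),
        weyl_connection_on (metric w c) (weyl_form w c) T Gam U,
        W = twistor_plane (T y) (Some z)
      & forall v, invariant_form T Gam (twistor_pt y z) v = 0].

(* Main.v *)
Require Import Defs.
From HB Require Import structures.
From mathcomp Require Import all_boot all_order all_algebra all_fingroup.
From mathcomp Require Import all_classical all_reals all_analysis.
From mathcomp Require Import complex ring lra.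
Import Defs.

(* In the fibre coordinate z, E_L = dz + (quadratic in z with coefficients the
   connection forms), so modulo E_L the 2-form dE_L is horizontal and equals the
   same quadratic expression in the curvature forms.  Restricting the equation
   to E_L = Lambda_L = F_L^* = 0 leaves the single complex number
   g(mu, R(mu^*, l) l), where l is the real null direction of the twistor plane
   Span{l, mu}.  Since Weyl curvature takes values in the conformal algebra,
   Ric(l, l) is twice the sum of this number and its conjugate.  Letting the
   plane vary, the symmetrised Ricci tensor vanishes on the null cone, hence is
   a multiple of the metric.  The frame in which the equation holds and the one
   in which S_ij is computed are compared through the coordinate frame: there
   the Weyl connection is given by Koszul's formula, and the curvature of any
   coframe is its gauge transform (by symmetry of second derivatives). *)

Set Implicit Arguments.
Unset Strict Implicit.
Unset Printing Implicit Defensive.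

Import Order.TTheory GRing.Theory Num.Theory.
Import numFieldNormedType.Exports.

Local Open Scope classical_set_scope.
Local Open Scope ring_scope.
Local Open Scope complex_scope.

(** * Derivatives of complex-valued functions *)

Section ComplexCalculus.
Context {R : realType} {V : normedModType R}.
Implicit Types (f g : V -> R[i]) (x v : V).

(** Here [mu = z n - p] and [l = k - z m - z^* p + z z^* n], so that [F_L = -2 g(mu, .)] and
    [Lambda_L = 2 g(l, .)]. The quadratic in [E_L] is, up to sign, the vector field by which a
    conformal matrix moves the planes in the fibre; this is why the fibre derivatives in [dE_L]
    reassemble into the commutator term of the curvature. The trace giving Ric(l, l) is taken in the
    frame [l], [m - z^* n], [p - z n], [n], whose dual coframe is [K], [F_L], the conjugate of
    [F_L], [-Lambda_L]. The [l] term vanishes by antisymmetry, the [n] term because a conformal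
    matrix maps the null vector [l] into its orthogonal; the other two terms are conjugate to each
    other. That conjugacy needs a real curvature, while the connection forms are given as complex
    data: reality is read off Koszul's formula in coordinates. The cotetrad supplied for a plane may
    change with the plane. Only frame-independent data are therefore carried over: the line of real
    vectors in the plane and the Ricci tensor in coordinates. Finite [z] in one fixed cotetrad
    misses a single null direction, yet determines a quadratic form up to multiples of the
    metric. *)

Definition cdiff f x :=
  differentiable (fun y => complex.Re (f y)) x /\
  differentiable (fun y => complex.Im (f y)) x.

Lemma cdiff_cst (c : R[i]) x : cdiff (fun _ => c) x.
Proof. by split; exact: differentiable_cst. Qed.

Lemma cdiffD f g x : cdiff f x -> cdiff g x -> cdiff (fun y => f y + g y) x.
Proof.
move=> [f1 f2] [g1 g2]; split.
- rewrite (_ : (fun y => _) = (fun y => complex.Re (f y)) + (fun y => complex.Re (g y))).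
    exact: differentiableD.
  by apply/funext => y; rewrite fctE; case: (f y) (g y) => [? ?] [? ?].
- rewrite (_ : (fun y => _) = (fun y => complex.Im (f y)) + (fun y => complex.Im (g y))).
    exact: differentiableD.
  by apply/funext => y; rewrite fctE; case: (f y) (g y) => [? ?] [? ?].
Qed.

Lemma ReM (a b : R[i]) : complex.Re (a * b) =
  complex.Re a * complex.Re b - complex.Im a * complex.Im b.
Proof. by case: a b => [? ?] [? ?]. Qed.

Lemma ImM (a b : R[i]) : complex.Im (a * b) =
  complex.Re a * complex.Im b + complex.Im a * complex.Re b.
Proof. by case: a b => [? ?] [? ?]. Qed.

Lemma ReMfun f g : (fun y => complex.Re (f y * g y)) =
  (fun y => complex.Re (f y)) * (fun y => complex.Re (g y)) -
  (fun y => complex.Im (f y)) * (fun y => complex.Im (g y)).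
Proof. by apply/funext => y; rewrite ReM. Qed.

Lemma ImMfun f g : (fun y => complex.Im (f y * g y)) =
  (fun y => complex.Re (f y)) * (fun y => complex.Im (g y)) +
  (fun y => complex.Im (f y)) * (fun y => complex.Re (g y)).
Proof. by apply/funext => y; rewrite ImM. Qed.

Lemma cdiffM f g x : cdiff f x -> cdiff g x -> cdiff (fun y => f y * g y) x.
Proof.
move=> [f1 f2] [g1 g2]; split; rewrite ?ReMfun ?ImMfun.
- by apply: differentiableB; apply: differentiableM.
- by apply: differentiableD; apply: differentiableM.
Qed.

Lemma cdiffN f x : cdiff f x -> cdiff (fun y => - f y) x.
Proof.
move=> fx; rewrite (_ : (fun y => _) = (fun y => -1 * f y)).
  by apply: cdiffM => //; exact: cdiff_cst.
by apply/funext => y; rewrite mulN1r.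
Qed.

Lemma cdiffB f g x : cdiff f x -> cdiff g x -> cdiff (fun y => f y - g y) x.
Proof. by move=> fx gx; apply: cdiffD => //; apply: cdiffN. Qed.

Lemma cdiff_sum (I : Type) (r : seq I) (P : pred I) (F : I -> V -> R[i]) x :
  (forall i, P i -> cdiff (F i) x) ->
  cdiff (fun y => \sum_(i <- r | P i) F i y) x.
Proof.
move=> Fx; elim: r => [|i r IH].
  rewrite (_ : (fun y => _) = fun=> 0); first exact: cdiff_cst.
  by apply/funext => y; rewrite big_nil.
rewrite (_ : (fun y => _) = fun y => if P i then F i y + \sum_(j <- r | P j) F j y
   else \sum_(j <- r | P j) F j y).
  by case: (P i) (Fx i) => // Fi; apply: cdiffD => //; exact: Fi.
by apply/funext => y; rewrite big_cons.
Qed.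

Lemma cdiff_prod (I : Type) (r : seq I) (P : pred I) (F : I -> V -> R[i]) x :
  (forall i, P i -> cdiff (F i) x) ->
  cdiff (fun y => \prod_(i <- r | P i) F i y) x.
Proof.
move=> Fx; elim: r => [|i r IH].
  rewrite (_ : (fun y => _) = fun=> 1); first exact: cdiff_cst.
  by apply/funext => y; rewrite big_nil.
rewrite (_ : (fun y => _) = fun y => if P i then F i y * \prod_(j <- r | P j) F j y
   else \prod_(j <- r | P j) F j y).
  by case: (P i) (Fx i) => // Fi; apply: cdiffM => //; exact: Fi.
by apply/funext => y; rewrite big_cons.
Qed.

Lemma cdiffV f x : cdiff f x -> f x != 0 -> cdiff (fun y => (f y)^-1) x.
Proof.
move=> [f1 f2] fx0.
set n2 := fun y => complex.Re (f y) ^+ 2 + complex.Im (f y) ^+ 2.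
have n2x : differentiable (fun y => (n2 y)^-1) x.
  apply: differentiableV.
    rewrite /n2; under eq_fun do rewrite !expr2.
    by apply: differentiableD; apply: differentiableM.
  move: fx0; rewrite eq_complex negb_and /n2 /= => fx0.
  by rewrite paddr_eq0 ?sqr_ge0// !sqrf_eq0 negb_and.
split.
- rewrite (_ : (fun y => _) = (fun y => complex.Re (f y)) * (fun y => (n2 y)^-1)).
    exact: differentiableM.
  by apply/funext => y; rewrite fctE /n2; case: (f y).
- rewrite (_ : (fun y => _) = - (fun y => complex.Im (f y)) * (fun y => (n2 y)^-1)).
    by apply: differentiableM => //; apply: differentiableN.
  by apply/funext => y; rewrite !fctE /n2; case: (f y) => ? ?; rewrite /= mulNr.
Qed.

Lemma cderiveD f g x v : cdiff f x -> cdiff g x ->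
  cderive (fun y => f y + g y) x v = cderive f x v + cderive g x v.
Proof.
move=> [f1 f2] [g1 g2]; rewrite /cderive.
rewrite (_ : (fun y => complex.Re _) =
  (fun y => complex.Re (f y)) + (fun y => complex.Re (g y))); last first.
  by apply/funext => y; rewrite fctE; case: (f y) (g y) => [? ?] [? ?].
rewrite (_ : (fun y => complex.Im _) =
  (fun y => complex.Im (f y)) + (fun y => complex.Im (g y))); last first.
  by apply/funext => y; rewrite fctE; case: (f y) (g y) => [? ?] [? ?].
by rewrite !deriveD//; apply: diff_derivable.
Qed.

Lemma cderiveM f g x v : cdiff f x -> cdiff g x ->
  cderive (fun y => f y * g y) x v = cderive f x v * g x + f x * cderive g x v.
Proof.
move=> [f1 f2] [g1 g2]; rewrite /cderive ReMfun ImMfun.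
rewrite deriveB ?deriveD; do ?[exact: diff_derivable|
  by apply: derivableM; exact: diff_derivable].
rewrite !deriveM; do ?exact: diff_derivable.
have Z (r s : R) : r *: (s : R^o) = r * s by [].
rewrite !Z; move: ('D_v _ x) ('D_v _ x) ('D_v _ x) ('D_v _ x) => p q r s.
case: (f x) (g x) => [a b] [c d] /=; apply/eqP; rewrite eq_complex /=.
by apply/andP; split; apply/eqP; ring.
Qed.

Lemma cderive_cst (c : R[i]) x v : cderive (fun=> c) x v = 0.
Proof. by rewrite /cderive !derive_cst. Qed.

Lemma cderiveN f x v : cdiff f x -> cderive (fun y => - f y) x v = - cderive f x v.
Proof.
move=> fx; rewrite (_ : (fun y => _) = (fun y => -1 * f y)).
  by rewrite cderiveM ?cderive_cst ?mul0r ?add0r ?mulN1r//; apply: cdiff_cst.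
by apply/funext => y; rewrite mulN1r.
Qed.

Lemma cderiveB f g x v : cdiff f x -> cdiff g x ->
  cderive (fun y => f y - g y) x v = cderive f x v - cderive g x v.
Proof. by move=> fx gx; rewrite cderiveD ?cderiveN//; exact: cdiffN. Qed.

Lemma cderive_sum (I : Type) (r : seq I) (P : pred I) (F : I -> V -> R[i]) x v :
  (forall i, P i -> cdiff (F i) x) ->
  cderive (fun y => \sum_(i <- r | P i) F i y) x v =
  \sum_(i <- r | P i) cderive (F i) x v.
Proof.
move=> Fx; elim: r => [|i r IH].
  rewrite big_nil (_ : (fun y => _) = fun=> 0) ?cderive_cst//.
  by apply/funext => y; rewrite big_nil.
rewrite big_cons; case: ifPn => [Pi|nPi].
  rewrite -IH -cderiveD; [|exact: Fx|exact: cdiff_sum].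
  by congr (cderive _ x v); apply/funext => y; rewrite big_cons Pi.
rewrite -IH.
by congr (cderive _ x v); apply/funext => y; rewrite big_cons (negbTE nPi).
Qed.

Lemma near_eq_cderive f g x v : {near x, f =1 g} -> cderive f x v = cderive g x v.
Proof.
move=> fg; rewrite /cderive.
have [->|v0] := eqVneq v 0; first by rewrite !derive0.
have E (p : R[i] -> R) : 'D_v (p \o f) x = 'D_v (p \o g) x.
  apply: near_eq_derive => //; near=> y => /=; congr p; near: y; exact: fg.
by rewrite (E (@complex.Re R)) (E (@complex.Im R)).
Unshelve. all: by end_near. Qed.

Lemma cderive_linear f x : cdiff f x ->
  forall (c : R) u v, cderive f x (c *: u + v) = c%:C * cderive f x u + cderive f x v.
Proof.
move=> [f1 f2] c u v; rewrite /cderive.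
have L (p : V -> R) : differentiable p x ->
    'D_(c *: u + v) p x = c * 'D_u p x + 'D_v p x.
  by move=> px; rewrite !deriveE// linearP.
rewrite !L//; move: ('D_v _ x) ('D_v _ x) ('D_u _ x) ('D_u _ x) => p q r s.
by apply/eqP; rewrite eq_complex /= !mul0r ?addr0 ?subr0 !eqxx.
Qed.

End ComplexCalculus.

(** * Symmetry of second derivatives *)

Section Schwarz.
Context {R : realType} {V : normedModType R}.
Implicit Types (f h : V -> R) (a x u v w : V) (s t : R).

Lemma is_derive_line h a w t : differentiable h (t *: w + a) ->
  is_derive t 1 (fun r : R => h (r *: w + a)) ('D_w h (t *: w + a)).
Proof.
move=> dh.
have E : (fun r : R => r^-1 *: (((fun r => h (r *: w + a)) \o shift t) (r *: 1) -
    h (t *: w + a))) =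
    (fun r : R => r^-1 *: ((h \o shift (t *: w + a)) (r *: w) - h (t *: w + a))).
  by apply/funext => r /=; rewrite -[r *: 1]/(r * 1) mulr1 scalerDl addrA.
split; first by rewrite /derivable E; exact: diff_derivable.
by rewrite /derive E.
Qed.

Lemma mean_value_line h a w s : 0 < s ->
  (forall t, 0 <= t <= s -> differentiable h (t *: w + a)) ->
  exists2 t, 0 <= t <= s & h (s *: w + a) - h a = 'D_w h (t *: w + a) * s.
Proof.
move=> s0 dh.
have [|| t] := @MVT R (fun r : R => h (r *: w + a))
    (fun t => 'D_w h (t *: w + a)) 0 s s0.
- move=> t; rewrite in_itv /= => /andP[t0 ts]; apply: is_derive_line.
  by apply: dh; rewrite !ltW.
- apply: derivable_within_continuous => t; rewrite in_itv /= => ts.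
  by have [] := is_derive_line (dh _ ts).
- rewrite in_itv /= scale0r add0r subr0 => /andP[t0 ts] E; exists t => //.
  by rewrite !ltW.
Qed.

(** The mean value theorem is applied twice: along [u] to the increment
    [g y = f (s *: v + y) - f y], then along [v] to ['D_u f]. *)
Lemma second_difference (U : set V) f x u v s : 0 < s ->
  (forall r t, 0 <= r <= s -> 0 <= t <= s -> U (t *: v + (r *: u + x))) ->
  (forall y, U y -> differentiable f y) ->
  (forall y, U y -> differentiable (fun y => 'D_u f y) y) ->
  exists r t, [/\ 0 <= r <= s, 0 <= t <= s &
    f (s *: v + (s *: u + x)) - f (s *: u + x) - (f (s *: v + x) - f x) =
    'D_v (fun y => 'D_u f y) (t *: v + (r *: u + x)) * s * s].
Proof.
move=> s0 Us df ddf.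
have ss : 0 <= s <= s by rewrite lexx ltW.
have oo : 0 <= (0 : R) <= s by rewrite lexx ltW.
pose g y := f (s *: v + y) - f y.
have dshift r : 0 <= r <= s ->
    differentiable (fun y => f (s *: v + y)) (r *: u + x).
  move=> rs; apply: (@differentiable_comp _ _ _ _ (fun y => s *: v + y) f).
    exact: differentiableD.
  exact/df/Us.
have df0 r : 0 <= r <= s -> differentiable f (r *: u + x).
  by move=> rs; apply: df; have := Us r 0 rs oo; rewrite scale0r add0r.
have [||r rs Er] := @mean_value_line g x u s.
- exact: s0.
- move=> r rs.
  exact: (differentiableB (dshift r rs) (df0 r rs)).
have [||t ts Et] := @mean_value_line (fun y => 'D_u f y) (r *: u + x) v s.
- exact: s0.
- by move=> t ts; apply: ddf; exact: Us.
exists r, t; split => //; rewrite -/(g _) -/(g _) Er -Et; congr (_ * _).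
rewrite /g deriveB; [|exact: diff_derivable (dshift _ rs)|exact: diff_derivable (df0 _ rs)].
congr (_ - _); rewrite /derive.
rewrite (_ : (fun h : R => _) = (fun h : R => h^-1 *:
  ((f \o shift (s *: v + (r *: u + x))) (h *: u) - f (s *: v + (r *: u + x)))))//.
by apply/funext => h /=; rewrite addrCA.
Qed.

(** The second difference over the parallelogram with sides [s u] and [s v] is symmetric in [u] and
    [v]. By [second_difference] it is [s^2] times either mixed derivative at some nearby point, and
    continuity brings both points back to [x]. *)
Lemma schwarz (U : set V) f x u v : open U -> U x ->
  (forall y, U y -> differentiable f y) ->
  (forall w y, U y -> differentiable (fun y => 'D_w f y) y) ->
  {for x, continuous (fun y => 'D_v (fun y => 'D_u f y) y)} ->
  {for x, continuous (fun y => 'D_u (fun y => 'D_v f y) y)} ->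
  'D_v (fun y => 'D_u f y) x = 'D_u (fun y => 'D_v f y) x.
Proof.
move=> oU Ux df ddf cvu cuv.
set Fvu := (fun y => 'D_v _ y) in cvu *; set Fuv := (fun y => 'D_u _ y) in cuv *.
apply/eqP; rewrite -subr_eq0 -normr_le0; apply/ler_addgt0Pl => e e0.
have e20 : 0 < e / 2 by rewrite divr_gt0.
rewrite addr0.
have : \forall y \near x, [/\ U y, `|Fvu x - Fvu y| < e / 2 & `|Fuv x - Fuv y| < e / 2].
  have H1 : nbhs x U by exact: (open_nbhs_nbhs (conj oU Ux)).
  have H2 : \forall y \near x, `|Fvu x - Fvu y| < e / 2.
    by move/cvgrPdist_lt : cvu; apply.
  have H3 : \forall y \near x, `|Fuv x - Fuv y| < e / 2.
    by move/cvgrPdist_lt : cuv; apply.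
  by apply: filterS3 H1 H2 H3 => y.
move=> /nbhs_normP[d /= d0 dP].
(* The summand 1 keeps [n] positive when [u] and [v] vanish; with sides scaled by [d / n / 2] the
   parallelogram stays in the ball of radius [d]. *)
set n := `|u| + `|v| + 1.
have n0 : 0 < n by rewrite ltr_wpDl// addr_ge0.
have s0 : 0 < d / n / 2 by rewrite !divr_gt0.
have bound w1 w2 r t : `|w1| + `|w2| = n - 1 -> 0 <= r <= d / n / 2 ->
    0 <= t <= d / n / 2 -> `|x - (t *: w2 + (r *: w1 + x))| < d.
  move=> w12 /andP[r0 rs] /andP[t0 ts].
  rewrite addrA opprD addrCA subrr addr0 normrN.
  apply: (le_lt_trans (ler_normD _ _)); rewrite !normrZ !ger0_norm//.
  apply: (@le_lt_trans _ _ (d / n / 2 * (n - 1))).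
    by rewrite -w12 mulrDr addrC lerD// ler_wpM2r.
  apply: (@lt_trans _ _ (d / n / 2 * n)).
    by rewrite ltr_pM2l// ltrBlDr ltrDl.
  by rewrite mulrAC divfK ?gt_eqF// ltr_pdivrMr// ltr_pMr// ltr1n.
have [|r1 [t1 [r1s t1s E1]]] := @second_difference U f x u v _ s0 _ df (ddf u).
  move=> r t rs ts; have [] // := dP (t *: v + (r *: u + x)).
  by apply: bound => //; rewrite /n addrK.
have [|r2 [t2 [r2s t2s E2]]] := @second_difference U f x v u _ s0 _ df (ddf v).
  move=> r t rs ts; have [] // := dP (t *: u + (r *: v + x)).
  by apply: bound => //; rewrite /n addrK addrC.
have B1 : `|x - (t1 *: v + (r1 *: u + x))| < d.
  by apply: bound => //; rewrite /n addrK.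
have B2 : `|x - (t2 *: u + (r2 *: v + x))| < d.
  by apply: bound => //; rewrite /n addrK addrC.
have [_ {}B1 _] := dP _ B1; have [_ _ {}B2] := dP _ B2.
have E : Fvu (t1 *: v + (r1 *: u + x)) = Fuv (t2 *: u + (r2 *: v + x)).
  have s1 : d / n / 2 != 0 by rewrite gt_eqF.
  apply: (mulIf s1); apply: (mulIf s1).
  apply: etrans (esym E1) _; apply: etrans _ E2.
  rewrite (addrCA (_ *: v) (_ *: u) x).
  by move: (f _) (f _) (f _) (f _) => p q r t; ring.
rewrite -E distrC in B2.
apply: le_trans (ler_distD (Fvu (t1 *: v + (r1 *: u + x))) _ _) _.
by rewrite (splitr e); apply: lerD; apply: ltW; [exact: B1|exact: B2].
Qed.

End Schwarz.

(** * Wedge products with 1-forms *)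

Section Wedge.
Context {R : realType} {V : normedModType R}.

Definition alternating {k} (a : form V k) (x : V) := forall v (s : 'S_k),
  a x (fun i => v (s i)) = (-1) ^+ s * a x v.

Lemma wedge_alternating k l (a : form V k) (b : form V l) x :
  alternating (a /w\ b) x.
Proof.
move=> v s; rewrite /wedge mulrCA; congr (_ * _).
rewrite (reindex_inj (mulIg s^-1)%g) mulr_sumr; apply: eq_bigr => t _ /=.
rewrite odd_permM odd_permV signr_addb [(-1) ^+ t * _]mulrC -mulrA; congr (_ * (_ * _)).
by congr (a _ _ * b _ _); apply/funext => i; rewrite permM permKV.
Qed.

(** Through [lift_perm], permutations are sorted by the image [j] of the last point. For fixed [j]
    the [k!] permutations of the other points give equal terms, as [alternating] absorbs their
    signs. The factor [k!] later cancels the normalisation of [wedge]. *)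
Lemma sum_alternating k (a : form V k) (b : form V 1) x (v : 'I_k.+1 -> V) :
  alternating a x ->
  \sum_(s : 'S_k.+1) (-1) ^+ s * (a x (fun i => v (s (lift ord_max i))) *
     b x (fun=> v (s ord_max))) =
  k`!%:R * \sum_(j < k.+1) (-1) ^+ (k + j) *
     (a x (fun i => v (lift j i)) * b x (fun=> v j)).
Proof.
move=> alta.
pose h (p : 'I_k.+1 * 'S_k) := lift_perm ord_max p.1 p.2.
have hinj : injective h.
  move=> [i s] [j t] /= hst.
  have ij : i = j by have := congr1 (fun u : 'S_k.+1 => u ord_max) hst; rewrite !lift_perm_id.
  congr pair => //; apply/permP => l; apply: (@lift_inj _ i).
  have := congr1 (fun u : 'S_k.+1 => u (lift ord_max l)) hst.
  by rewrite !lift_perm_lift -ij.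
have hbij : bijective h.
  by apply: (inj_card_bij hinj); rewrite card_prod card_ord !card_Sn factS.
rewrite (reindex h) /=; last exact: onW_bij.
rewrite -(pair_bigA _ (fun j s => (-1) ^+ lift_perm ord_max j s *
  (a x (fun i => v (lift_perm ord_max j s (lift ord_max i))) *
   b x (fun=> v (lift_perm ord_max j s ord_max))))) /= mulr_sumr.
apply: eq_bigr => j _.
transitivity (\sum_(s : 'S_k) (-1) ^+ (k + j) *
     (a x (fun i => v (lift j i)) * b x (fun=> v j))).
  apply: eq_bigr => s _.
  have -> : (-1) ^+ lift_perm ord_max j s = (-1) ^+ (k + j) * (-1) ^+ s :> R[i].
    by rewrite odd_lift_perm !signr_addb !signr_odd exprD.
  rewrite lift_perm_id.
  have -> : (fun i => v (lift_perm ord_max j s (lift ord_max i))) =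
      (fun i => (fun l => v (lift j l)) (s i)).
    by apply/funext => i; rewrite lift_perm_lift.
  rewrite (alta (fun l => v (lift j l))) -!mulrA; congr (_ * _).
  by rewrite [LHS]mulrA -expr2 sqrr_sign mul1r.
by rewrite sumr_const card_Sn mulr_natl.
Qed.

(** Laplace expansion along the 1-form. [w] is [v] transported to ['I_k.+1], which is not
    convertible to ['I_(k + 1)] for a variable [k]. *)
Lemma wedge_form1 k (a : form V k) (b : form V 1) x (v : 'I_(k + 1) -> V)
    (w : 'I_k.+1 -> V) :
  alternating a x -> (forall j, w j = v (cast_ord (esym (addn1 k)) j)) ->
  (a /w\ b) x v =
  \sum_(j < k.+1) (-1) ^+ (k + j) *
     (a x (fun i => w (lift j i)) * b x (fun=> w j)).
Proof.
move=> alta wv; have kN0 : k`!%:R != 0 :> R[i] by rewrite pnatr_eq0 -lt0n fact_gt0.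
rewrite /wedge -[RHS](mulKf kN0).
rewrite -(sum_alternating b w alta) muln1; congr (_ * _).
(* Stated for any [n] equal to [k + 1], so that eliminating the equality turns the casts into
   identities. *)
have cast n (e : (k + 1)%N = n) (G : ('I_k -> V) -> V -> R[i]) :
  \sum_(s : 'S_(k + 1)) (-1) ^+ s *
     G (fun i => v (s (lshift 1 i))) (v (s (rshift k ord0))) =
  \sum_(s : 'S_n) (-1) ^+ s *
     G (fun i => v (cast_ord (esym e) (s (cast_ord e (lshift 1 i)))))
       (v (cast_ord (esym e) (s (cast_ord e (rshift k ord0))))).
  case: n / e; apply: eq_bigr => s _; congr (_ * G _ _); last by rewrite !cast_ord_id.
  by apply/funext => i; rewrite !cast_ord_id.
transitivity (\sum_(s : 'S_(k + 1)) (-1) ^+ s *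
    (a x (fun i => v (s (lshift 1 i))) * b x (fun=> v (s (rshift k ord0))))).
  apply: eq_bigr => s _; congr (_ * (_ * b x _)); apply/funext => i.
  by rewrite ord1.
rewrite (cast _ (addn1 k) (fun f u => a x f * b x (fun=> u))).
have E1 : cast_ord (addn1 k) (rshift k ord0) = ord_max.
  by apply: val_inj; rewrite /= addn0.
have E2 i : cast_ord (addn1 k) (lshift 1 i) = lift ord_max i.
  by apply: val_inj; rewrite /= /bump leqNgt ltn_ord.
apply: eq_bigr => s _; rewrite E1 wv; congr (_ * (a x _ * b x _)).
by apply/funext => i; rewrite wv E2.
Qed.

(** The test vectors will be in triangular position with respect to the 1-form factors, so that the
    five-form collapses to a product of values, one factor at a time. *)
Lemma wedge_last k (a : form V k) (b : form V 1) x (v : 'I_(k + 1) -> V) :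
  alternating a x -> (forall i : 'I_k, b x (fun=> v (lshift 1 i)) = 0) ->
  (a /w\ b) x v = a x (fun i => v (lshift 1 i)) * b x (fun=> v (rshift k ord0)).
Proof.
move=> alta b0; rewrite (wedge_form1 _ alta (fun=> erefl)) (bigD1 ord_max)//= big1 => [|j jk].
  rewrite addr0 exprD -expr2 sqrr_sign mul1r; congr (a x _ * b x _).
    apply/funext => i; congr v; apply: val_inj.
    by rewrite /= /bump leqNgt ltn_ord.
  by apply/funext => i; congr v; apply: val_inj; rewrite /= addn0.
have [i ->] : exists i : 'I_k, j = lift ord_max i.
  by case: (unliftP ord_max j) jk => [i ->|->]; [exists i|rewrite eqxx].
rewrite [b x _](_ : _ = 0) ?mulr0// -[RHS](b0 i); congr (b x _).
apply/funext => _; congr v; apply: val_inj.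
by rewrite /= /bump leqNgt ltn_ord.
Qed.

Lemma alternating_form1 (a : form V 1) x : alternating a x.
Proof.
move=> w s; have -> : s = 1%g by apply/permP => i; rewrite !ord1.
by rewrite odd_perm1 expr0 mul1r; congr (a x _); apply/funext => i; rewrite perm1.
Qed.

Lemma wedge11 (a b : form V 1) x v : (a /w\ b) x v =
  a x (fun=> v 0) * b x (fun=> v 1) - a x (fun=> v 1) * b x (fun=> v 0).
Proof.
rewrite (@wedge_form1 _ a b x v v); first last.
- by move=> j; congr v; apply: val_inj.
- exact: alternating_form1.
rewrite !big_ord_recl big_ord0 /=.
have -> : (fun i => v (lift ord0 i)) = (fun=> v 1).
  by apply/funext => i; congr v; apply: val_inj; rewrite /= ord1.
have -> : (fun i => v (lift (lift ord0 ord0) i)) = (fun=> v 0).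
  by apply/funext => i; congr v; apply: val_inj; rewrite /= ord1.
have -> : (fun=> v ord0) = (fun=> v 0) :> ('I_1 -> V).
  by apply/funext => i; congr v; apply: val_inj.
have -> : (fun=> v (lift ord0 ord0)) = (fun=> v 1) :> ('I_1 -> V).
  by apply/funext => i; congr v; apply: val_inj.
by rewrite /bump /= !addn0 /=; ring.
Qed.

Lemma wedge21 (a : form V 2) (b : form V 1) x (u v w : V) (f : 'I_3 -> V) :
  alternating a x -> f 0 = u -> f 1 = v -> f ord_max = w -> b x (fun=> u) = 0 ->
  (a /w\ b) x f = a x (fun i => if i == 0 then u else v) * b x (fun=> w)
   - a x (fun i => if i == 0 then u else w) * b x (fun=> v).
Proof.
move=> alta f0 f1 f2 bu; rewrite (@wedge_form1 _ a b x f f)//; last first.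
  by move=> j; congr f; apply: val_inj.
rewrite !big_ord_recl big_ord0 /=.
have -> : (fun=> f ord0) = (fun=> u) :> ('I_1 -> V).
  by apply/funext => i; rewrite -f0; congr f; apply: val_inj.
have -> : (fun=> f (lift ord0 ord0)) = (fun=> v) :> ('I_1 -> V).
  by apply/funext => i; rewrite -f1; congr f; apply: val_inj.
have -> : (fun=> f (lift ord0 (lift ord0 ord0))) = (fun=> w) :> ('I_1 -> V).
  by apply/funext => i; rewrite -f2; congr f; apply: val_inj.
have -> : (fun i => f (lift (lift ord0 ord0) i)) = (fun i => if i == 0 then u else w).
  apply/funext => -[[|[|//]] i]; [rewrite -f0|rewrite -f2]; congr f; exact: val_inj.
have -> : (fun i => f (lift (lift ord0 (lift ord0 ord0)) i)) =
    (fun i => if i == 0 then u else v).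
  apply/funext => -[[|[|//]] i]; [rewrite -f0|rewrite -f1]; congr f; exact: val_inj.
by rewrite bu /bump /= !addn0 /=; ring.
Qed.

Lemma ext_d1 (a : form V 1) x v : ext_d a x v =
  cderive (fun y => a y (fun=> v 1)) x (v 0) - cderive (fun y => a y (fun=> v 0)) x (v 1).
Proof.
rewrite /ext_d !big_ord_recl big_ord0 addr0 expr0 mul1r expr1 mulN1r.
congr (cderive _ x _ - cderive _ x _).
- by apply/funext => y; congr (a y _); apply/funext => i; congr v; apply: val_inj; rewrite /= ord1.
- by apply/funext => y; congr (a y _); apply/funext => i; congr v; apply: val_inj; rewrite /= ord1.
- by congr v; apply: val_inj.
Qed.

Lemma ext_d1_alternating (a : form V 1) x : alternating (ext_d a) x.
Proof.
move=> v s; rewrite !ext_d1.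
have ord2 (i : 'I_2) : i != 0 -> i = 1.
  by move=> i0; apply: val_inj; move: i i0 => [[|[|[]]]].
have [s0|/ord2 s0] := eqVneq (s 0) 0.
  have s1 : s 1 = 1 by apply: ord2; rewrite -s0 (inj_eq perm_inj).
  have -> : s = 1%g.
    by apply/permP => i; rewrite perm1; have [->//|/ord2 ->] := eqVneq i 0.
  by rewrite odd_perm1 expr0 mul1r !perm1.
have s1 : s 1 = 0.
  by apply/eqP; apply: contraT => /ord2 s1; have := perm_inj (etrans s1 (esym s0)).
have -> : s = tperm 0 1.
  by apply/permP => i; have [->|/ord2 ->] := eqVneq i 0; rewrite ?tpermL ?tpermR.
by rewrite odd_tperm tpermL tpermR /= expr1 mulN1r opprB.
Qed.

End Wedge.

(** * Smooth maps and matrix-valued functions *)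

Section MatrixCalculus.
Context {R : realType}.

Lemma differentiable_near_eq {V W : normedModType R} (f g : V -> W) x :
  {near x, f =1 g} -> differentiable f x -> differentiable g x.
Proof.
move=> fg fx.
have [cf /eqaddoP ef] := (diff_locallyP x f).1 fx.
have gx : g x = f x by rewrite (nbhs_singleton fg).
have eg : g \o shift x = cst (g x) + 'd f x +o_ 0 id.
  apply/eqaddoP => e e0; rewrite gx.
  have fg0 : \forall y \near (0 : V), f (y + x) = g (y + x).
    by move: fg; rewrite (near_shift 0 x); apply: filterS => y; rewrite /= subr0 .
  near=> y.
  have -> : (g \o shift x - (cst (f x) + 'd f x)) y =
      (f \o shift x - (cst (f x) + 'd f x)) y.
    by rewrite !fctE /=; congr (_ - _); apply/esym; near: y; exact: fg0.
  by near: y; exact: (ef e e0).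
have dg := diff_unique cf eg.
by apply/diff_locallyP; rewrite dg.
Unshelve. all: by end_near. Qed.

(** The derivative of an entry is known to be the entry of the derivative only where the map is
    differentiable, that is on [U]; such equalities must pass through further derivatives, which
    openness of [U] permits. *)
Lemma Ck_on_eq {V W : normedModType R} (U : set V) k (f g : V -> W) :
  open U -> (forall x, U x -> f x = g x) -> Ck_on k U f -> Ck_on k U g.
Proof.
move=> oU; have nU x : U x -> nbhs x U by move=> Ux; exact: (open_nbhs_nbhs (conj oU Ux)).
elim: k f g => [|k IH] f g fg /=.
  move=> fc x Ux; change (g @ x --> g x); rewrite -(fg x Ux).
  apply: cvg_trans (fc x Ux); apply: near_eq_cvg.
  by apply: filterS (nU x Ux) => y /fg.
move=> [df ddf]; split=> [x Ux|v].
  apply: differentiable_near_eq (df x Ux).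
  by apply: filterS (nU x Ux) => y /fg.
apply: IH (ddf v) => x Ux; apply: near_eq_derive.
by apply: filterS (nU x Ux) => y /fg.
Qed.

Lemma smooth_on_entry {V : normedModType R} m n (U : set V)
    (h : V -> 'M[R]_(m.+1, n.+1)) i j :
  open U -> smooth_on U h -> smooth_on U (fun x => h x i j : R).
Proof.
move=> oU sh k; move: (sh k); elim: k h {sh} => [|k IH] h /=.
  move=> hc x Ux; apply: (@continuous_comp _ _ _ h (fun M => M i j)); first exact: hc.
  exact: (differentiable_continuous (differentiable_coord _ _ _)).
move=> [dh ddh]; split=> [x Ux|v].
  apply: (@differentiable_comp _ _ _ _ h (fun M => M i j)); first exact: dh.
  exact: differentiable_coord.
apply: Ck_on_eq (IH _ (ddh v)) => // x Ux.
by rewrite derive_mx ?mxE//; apply: diff_derivable; exact: dh.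
Qed.

Lemma smooth_schwarz {V : normedModType R} (U : set V) (f : V -> R) x u v :
  open U -> smooth_on U f -> U x ->
  'D_v (fun y => 'D_u f y) x = 'D_u (fun y => 'D_v f y) x.
Proof.
move=> oU sf Ux; apply: (@schwarz _ _ U) => //.
- exact: (sf 1%N).1.
- by move=> w; exact: ((sf 2%N).2 w).1.
- exact: (((sf 2%N).2 u).2 v).
- exact: (((sf 2%N).2 v).2 u).
Qed.

End MatrixCalculus.

(** * Entrywise derivatives of complex matrix-valued functions *)

Section MatrixDerivative.
Context {R : realType} {V : normedModType R}.

Definition mdiff {m n} (F : V -> 'M[R[i]]_(m, n)) x :=
  forall i j, cdiff (fun y => F y i j) x.

Definition mderive {m n} v (F : V -> 'M[R[i]]_(m, n)) x : 'M[R[i]]_(m, n) :=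
  \matrix_(i, j) cderive (fun y => F y i j) x v.

Lemma mdiff_mul m n p (F : V -> 'M[R[i]]_(m, n)) (G : V -> 'M[R[i]]_(n, p)) x :
  mdiff F x -> mdiff G x -> mdiff (fun y => F y *m G y) x.
Proof.
move=> dF dG i j; under eq_fun do rewrite mxE.
by apply: cdiff_sum => k _; apply: cdiffM.
Qed.

Lemma mdiffD m n (F G : V -> 'M[R[i]]_(m, n)) x :
  mdiff F x -> mdiff G x -> mdiff (fun y => F y + G y) x.
Proof. by move=> dF dG i j; under eq_fun do rewrite mxE; apply: cdiffD. Qed.

Lemma mdiff_tr m n (F : V -> 'M[R[i]]_(m, n)) x : mdiff F x -> mdiff (fun y => (F y)^T) x.
Proof. by move=> dF i j; under eq_fun do rewrite mxE. Qed.

Lemma cdiff_det n (F : V -> 'M[R[i]]_n) x : mdiff F x -> cdiff (fun y => \det (F y)) x.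
Proof.
move=> dF; apply: cdiff_sum => s _; apply: cdiffM; first exact: cdiff_cst.
exact: cdiff_prod.
Qed.

Lemma mdiff_adj n (F : V -> 'M[R[i]]_n) x : mdiff F x -> mdiff (fun y => \adj (F y)) x.
Proof.
move=> dF i j; under eq_fun do rewrite mxE /cofactor.
apply: cdiffM; first exact: cdiff_cst.
apply: cdiff_det => k l; under eq_fun do rewrite !mxE; exact: dF.
Qed.

(** [invmx] is defined by cases on invertibility; the adjugate formula is a rational expression in
    the entries, and agrees with it wherever the matrix is invertible. *)
Lemma mdiff_inv n (F : V -> 'M[R[i]]_n) x : F x \in unitmx -> mdiff F x ->
  mdiff (fun y => (\det (F y))^-1 *: \adj (F y)) x.
Proof.
move=> uF dF i j; under eq_fun do rewrite mxE.
apply: cdiffM; last exact: mdiff_adj.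
apply: cdiffV; first exact: cdiff_det.
by move: uF; rewrite unitmxE unitfE.
Qed.

Lemma mderive_mul m n p (F : V -> 'M[R[i]]_(m, n)) (G : V -> 'M[R[i]]_(n, p)) x v :
  mdiff F x -> mdiff G x ->
  mderive v (fun y => F y *m G y) x = mderive v F x *m G x + F x *m mderive v G x.
Proof.
move=> dF dG; apply/matrixP => i j; rewrite !mxE -big_split /=.
under eq_fun do rewrite mxE.
rewrite cderive_sum => [|k _]; last by apply: cdiffM.
by apply: eq_bigr => k _; rewrite cderiveM// !mxE.
Qed.

Lemma mderiveD m n (F G : V -> 'M[R[i]]_(m, n)) x v : mdiff F x -> mdiff G x ->
  mderive v (fun y => F y + G y) x = mderive v F x + mderive v G x.
Proof.
move=> dF dG; apply/matrixP => i j; rewrite !mxE -cderiveD//.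
by under eq_fun do rewrite mxE.
Qed.

Lemma mderive_tr m n (F : V -> 'M[R[i]]_(m, n)) x v :
  mderive v (fun y => (F y)^T) x = (mderive v F x)^T.
Proof. by apply/matrixP => i j; rewrite !mxE; under eq_fun do rewrite mxE. Qed.

Lemma near_eq_mderive m n (F G : V -> 'M[R[i]]_(m, n)) x v :
  {near x, F =1 G} -> mderive v F x = mderive v G x.
Proof.
move=> FG; apply/matrixP => i j; rewrite !mxE; apply: near_eq_cderive.
by apply: filterS FG => y ->.
Qed.

Definition csmooth (U : set V) (f : V -> R[i]) :=
  smooth_on U (fun y => complex.Re (f y)) /\ smooth_on U (fun y => complex.Im (f y)).

Lemma csmooth_entry m n (U : set V) (F : V -> 'M[R[i]]_(m.+1, n.+1)) i j :
  open U -> complex_smooth_on U F -> csmooth U (fun y => F y i j).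
Proof.
move=> oU [sR sI]; split.
- have := smooth_on_entry i j oU sR; by under eq_fun do rewrite mxE.
- have := smooth_on_entry i j oU sI; by under eq_fun do rewrite mxE.
Qed.

Lemma csmooth_cdiff (U : set V) f x : csmooth U f -> U x -> cdiff f x.
Proof. by move=> [sR sI] Ux; split; [apply: (sR 1%N).1|apply: (sI 1%N).1]. Qed.

Lemma csmooth_cderive (U : set V) f v : csmooth U f -> csmooth U (fun y => cderive f y v).
Proof. by move=> [sR sI]; split=> k; [exact: (sR k.+1).2|exact: (sI k.+1).2]. Qed.

Lemma csmooth_schwarz (U : set V) f x u v : open U -> csmooth U f -> U x ->
  cderive (fun y => cderive f y u) x v = cderive (fun y => cderive f y v) x u.
Proof.
move=> oU [sR sI] Ux; rewrite /cderive /=.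
by rewrite (smooth_schwarz u v oU sR Ux) (smooth_schwarz u v oU sI Ux).
Qed.

Lemma csmooth_real (U : set V) (f : V -> R) : smooth_on U f -> csmooth U (fun y => (f y)%:C).
Proof.
move=> sf; split=> // k; rewrite /=.
elim: k => [|k IH] /=; first by move=> x _; exact: cst_continuous.
split=> [x _|v]; first exact: differentiable_cst.
by under eq_fun do rewrite derive_cst.
Qed.

End MatrixDerivative.

(** * The Weyl connection in coordinates and in a coframe *)

Section CoordinateConnection.
Context {R : realType}.
Implicit Types (a b c : 'I_4) (x y : 'rV[R]_4).

Definition basis_vec a : 'rV[R]_4 := delta_mx 0 a.

Definition metric_weyl_derivative (G : 'rV[R]_4 -> 'M[R]_4) (A : 'rV[R]_4 -> 'rV[R]_4)
    a x : 'M[R[i]]_4 :=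
  mderive (basis_vec a) (fun y => complexify (G y)) x +
  (A x 0 a)%:C *: complexify (G x).

(* Koszul's formula, for the torsion-free connection with
   [d_a G + A_a G = G C_a + (G C_a)^T]. *)
Definition christoffel G A a x : 'M[R[i]]_4 :=
  let X := metric_weyl_derivative G A in
  invmx (complexify (G x)) *m
  \matrix_(c, b) (2^-1 * (X a x c b + X b x c a - X c x a b)).

Definition coord_curvature G A a b x : 'M[R[i]]_4 :=
  mderive (basis_vec a) (christoffel G A b) x
  - mderive (basis_vec b) (christoffel G A a) x
  + christoffel G A a x *m christoffel G A b x
  - christoffel G A b x *m christoffel G A a x.

Definition coord_ricci G A x : 'M[R[i]]_4 :=
  \matrix_(c, b) \sum_a coord_curvature G A a b x a c.

(** Of the six terms on the right, the symmetry under exchange of the outer indices cancels four in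
    pairs and identifies the remaining two. *)
Lemma koszul (X h : 'I_4 -> 'M[R[i]]_4) :
  (forall a, X a = h a + (h a)^T) -> (forall a b c, h a c b = h b c a) ->
  forall a c b, h a c b = 2^-1 * (X a c b + X b c a - X c a b).
Proof.
move=> Xh hs a c b; rewrite !Xh !mxE (hs b c a) (hs c a b) (hs a b c).
by field.
Qed.

Definition conn_mx (Gam : 'I_4 -> 'I_4 -> 'rV[R]_4 -> 'rV[R[i]]_4) a x : 'M[R[i]]_4 :=
  \matrix_(i, j) Gam i j x 0 a.

Definition frame_curvature Gam a b x : 'M[R[i]]_4 :=
  mderive (basis_vec a) (conn_mx Gam b) x - mderive (basis_vec b) (conn_mx Gam a) x
  + conn_mx Gam a x *m conn_mx Gam b x - conn_mx Gam b x *m conn_mx Gam a x.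

Lemma form_of_row_basis (f : 'rV[R]_4 -> 'rV[R[i]]_4) x a :
  form_of_row f x (fun=> basis_vec a) = f x 0 a.
Proof.
rewrite /form_of_row (bigD1 a)//= big1 ?addr0 => [|c ca]; rewrite mxE /=.
  by rewrite eqxx mulr1.
by rewrite (negbTE ca) mulr0.
Qed.

Context (G : 'rV[R]_4 -> 'M[R]_4) (A : 'rV[R]_4 -> 'rV[R]_4).
Context (T : 'rV[R]_4 -> 'M[R[i]]_4) (Gam : 'I_4 -> 'I_4 -> 'rV[R]_4 -> 'rV[R[i]]_4).
Context (U : set 'rV[R]_4).
Hypothesis coframeT : coframe_on T U.
Hypothesis weylT : weyl_connection_on G A T Gam U.
Hypothesis smoothG : forall x, U x -> mdiff (fun y => complexify (G y)) x.
Hypothesis symG : forall x, U x -> (G x)^T = G x.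
Hypothesis unitG : forall x, U x -> G x \in unitmx.

Let oU : open U. Proof. by case: coframeT. Qed.

Let nbhsU x : U x -> nbhs x U.
Proof. by move=> Ux; exact: (open_nbhs_nbhs (conj oU Ux)). Qed.

Let unitT x : U x -> T x \in unitmx.
Proof. by case: coframeT => _ _; apply. Qed.

Lemma coframe_mdiff x : U x -> mdiff T x.
Proof.
case: coframeT => _ sT _ Ux i j.
exact: (csmooth_cdiff (csmooth_entry i j oU sT) Ux).
Qed.

Lemma coframe_mdiff2 x v : U x -> mdiff (mderive v T) x.
Proof.
case: coframeT => _ sT _ Ux i j; under eq_fun do rewrite mxE.
exact: (csmooth_cdiff (csmooth_cderive v (csmooth_entry i j oU sT)) Ux).
Qed.

Lemma conn_mdiff a x : U x -> mdiff (conn_mx Gam a) x.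
Proof.
case: weylT => sG _ _ Ux i j; under eq_fun do rewrite mxE.
exact: (csmooth_cdiff (csmooth_entry 0 a oU (sG i j)) Ux).
Qed.

Let Tinv y := (\det (T y))^-1 *: \adj (T y).

Let TinvE x : U x -> Tinv x = invmx (T x).
Proof. by move=> Ux; rewrite /invmx unitT. Qed.

Let mdiffTinv x : U x -> mdiff Tinv x.
Proof. by move=> Ux; apply: mdiff_inv; [exact: unitT|exact: coframe_mdiff]. Qed.

(** The first structure equation on two coordinate vectors; after multiplication by the inverse of
    [T] it is the symmetry of the Christoffel symbols in their lower indices. *)
Lemma coframe_torsion x a b i : U x ->
  (mderive (basis_vec a) T x + conn_mx Gam a x *m T x) i b =
  (mderive (basis_vec b) T x + conn_mx Gam b x *m T x) i a.
Proof.
case: weylT => _ _ tor Ux.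
have := tor x Ux i (fun s => if s == 0 then basis_vec a else basis_vec b).
rewrite ext_d1 /=.
have -> : (fun y => theta T i y (fun=> basis_vec b)) = (fun y => T y i b).
  by apply/funext => y; rewrite /theta form_of_row_basis mxE.
have -> : (fun y => theta T i y (fun=> basis_vec a)) = (fun y => T y i a).
  by apply/funext => y; rewrite /theta form_of_row_basis mxE.
move=> E; rewrite !mxE.
have {}E : cderive (fun y => T y i b) x (basis_vec a) -
      cderive (fun y => T y i a) x (basis_vec b) =
    - (\sum_j (conn_mx Gam a x i j * T x j b) - \sum_j (conn_mx Gam b x i j * T x j a)).
  rewrite E -sumrB; congr (- _); apply: eq_bigr => j _.
  by rewrite wedge11 /= /theta !form_of_row_basis !mxE.
by move/eqP: E; rewrite subr_eq => /eqP ->; ring.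
Qed.

Lemma frame_metricK x : U x ->
  (T x)^T *m frame_metric G T x *m T x = complexify (G x).
Proof.
move=> Ux; rewrite /frame_metric !mulmxA -trmx_mul mulVmx ?unitT// trmx1 mul1mx.
by rewrite -mulmxA mulVmx ?unitT// mulmx1.
Qed.

Lemma frame_metric_sym x : U x -> (frame_metric G T x)^T = frame_metric G T x.
Proof.
move=> Ux; rewrite /frame_metric !trmx_mul trmxK -mulmxA.
rewrite (_ : (complexify (G x))^T = complexify (G x))//.
by apply/matrixP => i j; rewrite !mxE -[in RHS](symG Ux) mxE.
Qed.

Lemma frame_metric_mdiff x : U x -> mdiff (fun y => (Tinv y)^T *m complexify (G y) *m Tinv y) x.
Proof.
move=> Ux; apply: mdiff_mul; last exact: mdiffTinv.
by apply: mdiff_mul; [apply: mdiff_tr; exact: mdiffTinv|exact: smoothG].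
Qed.

Lemma frame_metric_compat x a : U x ->
  mderive (basis_vec a) (frame_metric G T) x =
  frame_metric G T x *m conn_mx Gam a x +
  (frame_metric G T x *m conn_mx Gam a x)^T - (A x 0 a)%:C *: frame_metric G T x.
Proof.
case: weylT => _ comp _ Ux; apply/matrixP => i j.
have := comp x Ux i j (fun=> basis_vec a).
rewrite /ext_d big_ord1 expr0 mul1r !mxE form_of_row_basis mxE => E.
rewrite -[LHS](subrK (\sum_k frame_metric G T x i k * Gam k j x 0 a)).
have -> : \sum_k frame_metric G T x i k * conn_mx Gam a x k j =
    \sum_k frame_metric G T x i k * form_of_row (Gam k j) x (fun=> basis_vec a).
  by apply: eq_bigr => k _; rewrite form_of_row_basis !mxE.
have -> : \sum_k frame_metric G T x i k * Gam k j x 0 a =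
    \sum_k frame_metric G T x i k * form_of_row (Gam k j) x (fun=> basis_vec a).
  by apply: eq_bigr => k _; rewrite form_of_row_basis !mxE.
have -> : \sum_k frame_metric G T x j k * conn_mx Gam a x k i =
    \sum_k frame_metric G T x j k * form_of_row (Gam k i) x (fun=> basis_vec a).
  by apply: eq_bigr => k _; rewrite form_of_row_basis !mxE.
rewrite -mulNr in E; move/eqP: E; rewrite subr_eq => /eqP ->; ring.
Qed.

(** The gauge transform of [Gam] to the coordinate frame. *)
Let christoffel_frame a x := Tinv x *m (mderive (basis_vec a) T x + conn_mx Gam a x *m T x).

Let christoffel_frame_mdiff a x : U x -> mdiff (christoffel_frame a) x.
Proof.
move=> Ux; apply: mdiff_mul; first exact: mdiffTinv.
apply: mdiffD; first exact: coframe_mdiff2.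
by apply: mdiff_mul; [exact: conn_mdiff|exact: coframe_mdiff].
Qed.

(** Uniqueness of the Weyl connection. For [h a], the product of [G] and the transformed connection,
    compatibility says [X a = h a + (h a)^T] and absence of torsion says that [h] is symmetric in
    its outer indices; [koszul] then determines [h]. *)
Lemma christoffel_frameE a x : U x -> christoffel_frame a x = christoffel G A a x.
Proof.
move=> Ux; have GU : complexify (G x) \in unitmx by rewrite map_unitmx unitG.
have [g gE] : {g | g = frame_metric G T x} by exists (frame_metric G T x).
set D := fun a => mderive (basis_vec a) T x.
set Q := fun a => D a + conn_mx Gam a x *m T x.
pose h a := (T x)^T *m g *m Q a.
have hE b : h b = complexify (G x) *m christoffel_frame b x.
  rewrite /christoffel_frame TinvE// mulmxA -(frame_metricK Ux) -gE.
  by rewrite mulmxK ?unitT.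
(* The product rule for [G = T^T g T]. Near [x] the inverse inside [g] is replaced by the adjugate
   formula, which is differentiable entry by entry. *)
have dG b : mderive (basis_vec b) (fun y => complexify (G y)) x =
    (D b)^T *m g *m T x +
    (T x)^T *m mderive (basis_vec b) (frame_metric G T) x *m T x + (T x)^T *m g *m D b.
  have TgT y : U y -> (Tinv y)^T *m complexify (G y) *m Tinv y = frame_metric G T y.
    by move=> Uy; rewrite TinvE.
  rewrite -(@near_eq_mderive _ _ _ _ (fun y => (Tinv y)^T *m complexify (G y) *m Tinv y)
    (frame_metric G T)); last by apply: filterS (nbhsU Ux) => y /TgT.
  rewrite -(@near_eq_mderive _ _ _ _ (fun y => (T y)^T *m
    ((Tinv y)^T *m complexify (G y) *m Tinv y) *m T y) (fun y => complexify (G y))); last first.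
    by apply: filterS (nbhsU Ux) => y Uy; rewrite TgT// frame_metricK.
  have dT := coframe_mdiff Ux; have dg := frame_metric_mdiff Ux.
  rewrite (mderive_mul _ (mdiff_mul (mdiff_tr dT) dg) dT).
  by rewrite (mderive_mul _ (mdiff_tr dT) dg) mderive_tr mulmxDl (TgT _ Ux) -gE.
have Xh b : metric_weyl_derivative G A b x = h b + (h b)^T.
  rewrite /metric_weyl_derivative dG frame_metric_compat// -(frame_metricK Ux) -gE.
  have gT : g^T = g by rewrite gE frame_metric_sym.
  rewrite /h /Q !mulmxDr [(_ + _)^T]linearD /= !trmx_mul !trmxK gT !mulmxDl.
  rewrite mulmxN mulNmx -scalemxAr -scalemxAl !mulmxA.
  have shuffle (W : zmodType) (p q r t s : W) : p + (q + r - t) + s + t = s + q + (p + r).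
    rewrite (addrAC _ s) -[p + _ + t]addrA subrK addrC -[in RHS]addrA; congr (_ + _).
    by rewrite addrCA.
  exact: shuffle.
have hs b c d : h b c d = h d c b.
  rewrite /h [LHS]mxE [RHS]mxE.
  by apply: eq_bigr => i _; rewrite /Q /D coframe_torsion.
rewrite /christoffel -[LHS](mulKmx GU) -hE; congr (_ *m _).
by apply/matrixP => c b; rewrite [RHS]mxE; 
   exact: (@koszul (fun d => metric_weyl_derivative G A d x) h Xh (fun a b c => hs a c b)).
Qed.

(** With [C] the Christoffel matrices, [dT = T C - Gam T]. A second differentiation, the equality of
    mixed derivatives of [T], and substitution of [dT] once more leave exactly the covariance of the
    curvature. *)
Lemma frame_curvatureE a b x : U x ->
  frame_curvature Gam a b x *m T x = T x *m coord_curvature G A a b x.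
Proof.
move=> Ux.
have dC c y : U y -> mderive (basis_vec c) T y =
    T y *m christoffel_frame c y - conn_mx Gam c y *m T y.
  move=> Uy; rewrite /christoffel_frame TinvE// mulmxA mulmxV ?unitT// mul1mx.
  by rewrite addrK.
have dd c d : mderive (basis_vec d) (mderive (basis_vec c) T) x =
    mderive (basis_vec d) T x *m christoffel G A c x +
    T x *m mderive (basis_vec d) (christoffel G A c) x
    - (mderive (basis_vec d) (conn_mx Gam c) x *m T x +
       conn_mx Gam c x *m mderive (basis_vec d) T x).
  have dT := coframe_mdiff Ux.
  rewrite -(@near_eq_mderive _ _ _ _ (christoffel_frame c) (christoffel G A c)); last first.
    by apply: filterS (nbhsU Ux) => y; exact: christoffel_frameE.
  rewrite -christoffel_frameE// -mderive_mul//; last exact: christoffel_frame_mdiff.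
  rewrite -mderive_mul//; last exact: conn_mdiff.
  apply/eqP; rewrite eq_sym subr_eq -mderiveD; first last.
  - by apply: mdiff_mul => //; exact: conn_mdiff.
  - exact: coframe_mdiff2.
  apply/eqP; apply: near_eq_mderive; apply: filterS (nbhsU Ux) => y Uy.
  by rewrite dC// subrK.
have sw : mderive (basis_vec b) (mderive (basis_vec a) T) x =
    mderive (basis_vec a) (mderive (basis_vec b) T) x.
  apply/matrixP => i j; rewrite [LHS]mxE [RHS]mxE.
  have E c : (fun y => mderive (basis_vec c) T y i j) =
      (fun y => cderive (fun z => T z i j) y (basis_vec c)).
    by apply/funext => y; rewrite mxE.
  rewrite !E.
  case: coframeT => _ sT _.
  exact: (csmooth_schwarz _ _ oU (csmooth_entry i j oU sT) Ux).
move: sw; rewrite (dd a b) (dd b a) (dC a x Ux) (dC b x Ux).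
rewrite (christoffel_frameE a Ux) (christoffel_frameE b Ux).
rewrite /frame_curvature /coord_curvature.
move: (mderive (basis_vec a) (conn_mx _ _) _) (mderive (basis_vec b) (conn_mx _ _) _).
move: (mderive (basis_vec a) (christoffel _ _ _) _).
move: (mderive (basis_vec b) (christoffel _ _ _) _).
move: (christoffel _ _ a _) (christoffel _ _ b _) (conn_mx _ a _) (conn_mx _ b _) (T x).
move=> Ca Cb Ga Gb t p q r s' .
have shuffle (cba gbca tdc dgt gacb gabt cab tdc' dgt' gbat : 'M[R[i]]_4) :
    cba - gbca + tdc - (dgt + (gacb - gabt)) = cab - gacb + tdc' - (dgt' + (gbca - gbat)) ->
    dgt' - dgt + gabt - gbat = tdc' - tdc + cab - cba.
  move=> /matrixP E; apply/matrixP => i j; move: (E i j); rewrite !mxE.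
  move/eqP; rewrite -subr_eq0 => /eqP E0; apply/eqP; rewrite -subr_eq0; apply/eqP.
  by rewrite -[RHS]E0; ring.
rewrite !(mulmxDr, mulmxDl) !(mulNmx, mulmxN) !mulmxA.
exact: shuffle.
Qed.

Lemma curvature_form_basis i j a b x :
  curvature_form G T Gam i j x (fun s : 'I_2 => delta_mx 0 (if s == 0 then a else b)) =
  (frame_metric G T x *m frame_curvature Gam a b x) i j.
Proof.
rewrite /curvature_form mxE; apply: eq_bigr => h _; congr (_ * _).
rewrite ext_d1 /= -/(basis_vec a) -/(basis_vec b).
under eq_fun do rewrite form_of_row_basis.
under [X in _ - cderive X _ _]eq_fun do rewrite form_of_row_basis.
under eq_bigr do rewrite wedge11 /= -/(basis_vec a) -/(basis_vec b) !form_of_row_basis.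
rewrite sumrB /frame_curvature ![in RHS]mxE addrA; congr (_ - _ + _ - _).
- by congr (cderive _ _ _); apply/funext => y; rewrite mxE.
- by congr (cderive _ _ _); apply/funext => y; rewrite mxE.
- by apply: eq_bigr => k _; rewrite !mxE.
- by apply: eq_bigr => k _; rewrite !mxE.
Qed.

Lemma frame_metric_unit x : U x -> frame_metric G T x \in unitmx.
Proof.
move=> Ux; rewrite /frame_metric !unitmx_mul unitmx_tr unitmx_inv unitT//=.
by rewrite map_unitmx unitG.
Qed.

Lemma inv_frame_metric_sym x i k : U x ->
  invmx (frame_metric G T x) i k = invmx (frame_metric G T x) k i.
Proof. by move=> Ux; rewrite -[in LHS](frame_metric_sym Ux) -trmx_inv mxE. Qed.

(** The contraction with the inverse metric undoes the lowering of the index in [curvature_form].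
    The Ricci tensor is thus a trace of the curvature endomorphism, which the gauge transformation
    carries to coordinates. *)
Lemma ricciE x j l : U x ->
  ricci G T Gam x j l = ((invmx (T x))^T *m coord_ricci G A x *m invmx (T x)) j l.
Proof.
move=> Ux; set Ti := invmx (T x); set g := frame_metric G T x.
have E k i j' : riemann G T Gam x i j' k l =
    \sum_a \sum_b Ti a k * Ti b l * (g *m frame_curvature Gam a b x) i j'.
  apply: eq_bigr => a _; apply: eq_bigr => b _.
  by rewrite curvature_form_basis !mxE.
rewrite /ricci; under eq_bigr do under eq_bigr do rewrite E mulr_sumr.
under eq_bigr do under eq_bigr do under eq_bigr do rewrite mulr_sumr.
rewrite exchange_big /=; under eq_bigr do rewrite exchange_big /=.
under eq_bigr do under eq_bigr do rewrite exchange_big /=.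
rewrite exchange_big /=; under eq_bigr do rewrite exchange_big /=.
transitivity (\sum_a \sum_b Ti b l * (coord_curvature G A a b x *m Ti) a j).
  apply: eq_bigr => a _; apply: eq_bigr => b _.
  have -> : coord_curvature G A a b x *m Ti = Ti *m frame_curvature Gam a b x.
    have := frame_curvatureE a b Ux => /(congr1 (fun M => Ti *m M *m Ti)).
    by rewrite !mulmxA /Ti mulVmx ?unitT// mul1mx -mulmxA mulmxV ?unitT// mulmx1.
  rewrite mxE mulr_sumr; apply: eq_bigr => k _.
  transitivity (Ti a k * Ti b l *
      \sum_i invmx g k i * (g *m frame_curvature Gam a b x) i j).
    by rewrite mulr_sumr; apply: eq_bigr => i _; rewrite inv_frame_metric_sym// -/g; ring.
  have -> : \sum_i invmx g k i * (g *m frame_curvature Gam a b x) i j =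
      (invmx g *m (g *m frame_curvature Gam a b x)) k j by rewrite mxE.
  by rewrite mulKmx ?frame_metric_unit//; ring.
rewrite exchange_big [RHS]mxE; apply: eq_bigr => b _.
rewrite mxE mulr_suml.
transitivity (\sum_a \sum_c Ti b l * (coord_curvature G A a b x a c * Ti c j)).
  by apply: eq_bigr => a _; rewrite mxE mulr_sumr.
rewrite exchange_big; apply: eq_bigr => c _.
by rewrite !mxE mulr_sumr mulr_suml; apply: eq_bigr => a _; ring.
Qed.

Lemma tracefree_ricci_eq0 x (s : R[i]) : U x ->
  coord_ricci G A x + (coord_ricci G A x)^T = s *: complexify (G x) ->
  forall i j, tracefree_ricci G T Gam x i j = 0.
Proof.
move=> Ux Es; set g := frame_metric G T x.
have E i j : ricci G T Gam x i j + ricci G T Gam x j i = s * g i j.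
  rewrite !ricciE//; set Ti := invmx (T x).
  transitivity ((Ti^T *m (coord_ricci G A x + (coord_ricci G A x)^T) *m Ti) i j).
    rewrite mulmxDr mulmxDl [RHS]mxE; congr (_ + _).
    rewrite (_ : Ti^T *m (coord_ricci G A x)^T *m Ti =
      (Ti^T *m coord_ricci G A x *m Ti)^T); first by rewrite [RHS]mxE.
    by rewrite !trmx_mul trmxK mulmxA.
  by rewrite Es -scalemxAr -scalemxAl mxE.
(* Only the symmetric part of Ricci meets the inverse metric, whose full contraction with [g] is 4:
   twice the scalar curvature is [4 s]. *)
have scal : scalar_curv G T Gam x = 2 * s.
  have two : 2 != 0 :> R[i] by rewrite pnatr_eq0.
  apply: (mulfI two).
  transitivity (scalar_curv G T Gam x + scalar_curv G T Gam x); first by ring.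
  have sw : scalar_curv G T Gam x = \sum_i \sum_j invmx g i j * ricci G T Gam x j i.
    rewrite /scalar_curv exchange_big; apply: eq_bigr => i _; apply: eq_bigr => j _.
    by rewrite inv_frame_metric_sym.
  rewrite {1}sw /scalar_curv -big_split /=.
  transitivity (\sum_i s * (invmx g *m g) i i).
    apply: eq_bigr => i _; rewrite -big_split mxE mulr_sumr /=.
    by apply: eq_bigr => k _; rewrite -mulrDr E -/g; ring.
  rewrite mulVmx ?frame_metric_unit//.
  by under eq_bigr do rewrite mxE eqxx mulr1; rewrite sumr_const card_ord; ring.
by move=> i j; rewrite /tracefree_ricci scal E -/g; field.
Qed.

End CoordinateConnection.

(** * Null cotetrads and the twistor forms *)

Section TwistorCalculus.
Context {R : realType}.
Local Notation TS := (@twistor_space R).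

Lemma cderive_row_sum (f : 'rV[R]_4 -> R[i]) x u : cdiff f x ->
  cderive f x u = \sum_a (u 0 a)%:C * cderive f x (basis_vec a).
Proof.
move=> fx; rewrite [in LHS](row_sum_delta u).
have c0 : cderive f x 0 = 0.
  have := cderive_linear fx 1 0 0.
  by rewrite scaler0 addr0 mul1r => /eqP; rewrite -subr_eq0 opprD addNKr oppr_eq0 => /eqP.
elim: (index_enum _) => [|a r IH]; first by rewrite !big_nil.
by rewrite !big_cons cderive_linear// IH.
Qed.

Lemma differentiable_fst {V W : normedModType R} (q : V * W) : differentiable (fst : V * W -> V) q.
Proof. by apply: linear_differentiable => p; exact: cvg_fst. Qed.

Lemma differentiable_snd {V W : normedModType R} (q : V * W) : differentiable (snd : V * W -> W) q.
Proof. by apply: linear_differentiable => p; exact: cvg_snd. Qed.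

Lemma zcoord_cdiff (q : TS) : cdiff (@zcoord R) q.
Proof.
split.
- apply: (@differentiable_comp _ _ _ _ (snd : TS -> (R^o * R^o)%type) fst).
    exact: differentiable_snd.
  exact: differentiable_fst.
- apply: (@differentiable_comp _ _ _ _ (snd : TS -> (R^o * R^o)%type) snd).
    exact: differentiable_snd.
  exact: differentiable_snd.
Qed.

Lemma pullback_cdiff (f : 'rV[R]_4 -> R[i]) (q : TS) :
  cdiff f q.1 -> cdiff (fun q' : TS => f q'.1) q.
Proof.
move=> [f1 f2]; split.
- apply: (@differentiable_comp _ _ _ _ (fst : TS -> 'rV[R]_4) (fun x => complex.Re (f x))) => //.
  exact: differentiable_fst.
- apply: (@differentiable_comp _ _ _ _ (fst : TS -> 'rV[R]_4) (fun x => complex.Im (f x))) => //.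
  exact: differentiable_fst.
Qed.

Lemma pullback_cderive (f : 'rV[R]_4 -> R[i]) (q v : TS) :
  cderive (fun q' : TS => f q'.1) q v = cderive f q.1 v.1.
Proof. by []. Qed.

Lemma zcoord_cderive (q v : TS) : cderive (@zcoord R) q v = zcoord v.
Proof.
have D (p : TS -> R) : (forall h : R, p (h *: v + q) = h * p v + p q) -> 'D_v p q = p v.
  move=> pl; rewrite /derive; apply: cvg_lim => //.
  apply: cvg_near_cst; near=> h.
  have h0 : h != 0 by near: h; exact: nbhs_dnbhs_neq.
  by rewrite /= pl addrK -[h^-1 *: _]/(h^-1 * _) mulKf.
by rewrite /cderive /zcoord; congr (_ +i* _); apply: D.
Unshelve. all: by end_near. Qed.

End TwistorCalculus.

(** * The conformal algebra in a null cotetrad *)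

Section NullFrame.
Context {R : realType}.
Local Notation TS := (@twistor_space R).
Implicit Types (a b c : 'I_4) (x y : 'rV[R]_4).

Lemma sum4 (V : nmodType) (F : 'I_4 -> V) :
  \sum_i F i = F i1 + F i2 + F i3 + F i4.
Proof.
rewrite !big_ord_recl big_ord0 addr0 !addrA.
by congr (F _ + F _ + F _ + F _); apply: val_inj.
Qed.

Lemma ord4_ind (P : 'I_4 -> Prop) : P i1 -> P i2 -> P i3 -> P i4 -> forall i, P i.
Proof.
move=> P1 P2 P3 P4 [[|[|[|[|//]]]] p].
- by rewrite (_ : Ordinal p = i1)//; apply: val_inj.
- by rewrite (_ : Ordinal p = i2)//; apply: val_inj.
- by rewrite (_ : Ordinal p = i3)//; apply: val_inj.
- by rewrite (_ : Ordinal p = i4)//; apply: val_inj.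
Qed.

(* The Lie algebra of the conformal group of [MP - NK]. *)
Definition weyl_algebra (M : 'M[R[i]]_4) :=
  [/\ [/\ M i1 i2 = 0, M i2 i1 = 0, M i3 i4 = 0 & M i4 i3 = 0],
      [/\ M i4 i1 = M i2 i3, M i3 i1 = M i2 i4, M i4 i2 = M i1 i3 & M i3 i2 = M i1 i4]
    & M i4 i4 = M i1 i1 + M i2 i2 - M i3 i3].

Lemma weyl_algebraD M N : weyl_algebra M -> weyl_algebra N -> weyl_algebra (M + N).
Proof.
move=> [[m1 m2 m3 m4] [m5 m6 m7 m8] m9] [[n1 n2 n3 n4] [n5 n6 n7 n8] n9].
split; first by split; rewrite mxE ?m1 ?m2 ?m3 ?m4 ?n1 ?n2 ?n3 ?n4 addr0.
  by split; rewrite !mxE ?m5 ?m6 ?m7 ?m8 ?n5 ?n6 ?n7 ?n8.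
by rewrite !mxE m9 n9; ring.
Qed.

Lemma weyl_algebraZ (k : R[i]) M : weyl_algebra M -> weyl_algebra (k *: M).
Proof.
move=> [[m1 m2 m3 m4] [m5 m6 m7 m8] m9].
split; first by split; rewrite mxE ?m1 ?m2 ?m3 ?m4 mulr0.
  by split; rewrite !mxE ?m5 ?m6 ?m7 ?m8.
by rewrite !mxE m9; ring.
Qed.

Lemma weyl_algebraB M N : weyl_algebra M -> weyl_algebra N -> weyl_algebra (M - N).
Proof. by move=> wM wN; rewrite -[- N]scaleN1r; apply: weyl_algebraD => //; apply: weyl_algebraZ. Qed.

Lemma weyl_algebra_sum (I : Type) (r : seq I) (F : I -> 'M[R[i]]_4) :
  (forall i, weyl_algebra (F i)) -> weyl_algebra (\sum_(i <- r) F i).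
Proof.
move=> wF; elim: r => [|i r IH]; last by rewrite big_cons; apply: weyl_algebraD.
by rewrite big_nil; split; [split|split|]; rewrite !mxE//; ring.
Qed.

Lemma weyl_algebra_comm M N : weyl_algebra M -> weyl_algebra N ->
  weyl_algebra (M *m N - N *m M).
Proof.
move=> [[m1 m2 m3 m4] [m5 m6 m7 m8] m9] [[n1 n2 n3 n4] [n5 n6 n7 n8] n9].
split; [split|split|]; rewrite !mxE !sum4;
  rewrite ?m1 ?m2 ?m3 ?m4 ?n1 ?n2 ?n3 ?n4 ?m5 ?m6 ?m7 ?m8 ?n5 ?n6 ?n7 ?n8 ?m9 ?n9; ring.
Qed.

(** The equations defining [weyl_algebra] are linear with constant coefficients, so they survive
    differentiation. *)
Lemma weyl_algebra_mderive (V : normedModType R) (F : V -> 'M[R[i]]_4) (x v : V) :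
  mdiff F x -> (\forall y \near x, weyl_algebra (F y)) -> weyl_algebra (mderive v F x).
Proof.
move=> dF wF.
have E i j k l : (forall M, weyl_algebra M -> M i j = M k l) ->
    mderive v F x i j = mderive v F x k l.
  by move=> H; rewrite !mxE; apply: near_eq_cderive; apply: filterS wF => y /H.
have Z i j : (forall M, weyl_algebra M -> M i j = 0) -> mderive v F x i j = 0.
  move=> H; rewrite mxE -(cderive_cst 0 x v); apply: near_eq_cderive.
  by apply: filterS wF => y /H.
split; first by split; apply: Z => M [[]].
  by split; apply: E => M [_ []].
rewrite !mxE -cderiveD// -cderiveB//; last exact: cdiffD.
by apply: near_eq_cderive; apply: filterS wF => y [].
Qed.

Definition null_metric : 'M[R[i]]_4 := \matrix_(i, j)
  (2^-1 * (((i == i1) && (j == i2) || (i == i2) && (j == i1))%:R -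
           ((i == i3) && (j == i4) || (i == i4) && (j == i3))%:R)).

Lemma null_cotetradE (G : 'M[R]_4) (T : 'M[R[i]]_4) : null_cotetrad G T ->
  complexify G = T^T *m null_metric *m T.
Proof.
move=> [_ _ GT _]; apply/matrixP => a b; rewrite mxE GT mxE sum4 !mxE !sum4 !mxE /=.
by field.
Qed.

Lemma null_frame_metric (G : 'rV[R]_4 -> 'M[R]_4) (T : 'rV[R]_4 -> 'M[R[i]]_4) x :
  T x \in unitmx -> null_cotetrad (G x) (T x) -> frame_metric G T x = null_metric.
Proof.
move=> uT /null_cotetradE E; rewrite /frame_metric E !mulmxA -trmx_mul mulmxV//.
by rewrite trmx1 mul1mx -mulmxA mulmxV// mulmx1.
Qed.

(** Of the ten scalar equations, the four diagonal ones give the zeros and the four mixing the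
    labels 1, 2 with 3, 4 give the equalities of entries. The last two both express [t], and
    comparing them gives the relation on the diagonal. *)
Lemma null_metric_weyl_algebra (M : 'M[R[i]]_4) (t : R[i]) :
  null_metric *m M + (null_metric *m M)^T = t *: null_metric -> weyl_algebra M.
Proof.
move=> /matrixP E.
have r1 j : (null_metric *m M) i1 j = 2^-1 * M i2 j by rewrite mxE sum4 !mxE /=; ring.
have r2 j : (null_metric *m M) i2 j = 2^-1 * M i1 j by rewrite mxE sum4 !mxE /=; ring.
have r3 j : (null_metric *m M) i3 j = - (2^-1 * M i4 j) by rewrite mxE sum4 !mxE /=; ring.
have r4 j : (null_metric *m M) i4 j = - (2^-1 * M i3 j) by rewrite mxE sum4 !mxE /=; ring.
have H i j : (null_metric *m M) i j + (null_metric *m M) j i = t * null_metric i j.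
  have -> : t * null_metric i j = (t *: null_metric) i j by rewrite [RHS]mxE.
  by rewrite -E [RHS]mxE; congr (_ + _); rewrite [RHS]mxE.
have half (u v w : R[i]) : 2^-1 * u + 2^-1 * v = w -> u = 2 * w - v.
  by move=> <-; field.
have halfN (u v w : R[i]) : - (2^-1 * u) - 2^-1 * v = w -> u = - 2 * w - v.
  by move=> <-; field.
have halfB (u v w : R[i]) : 2^-1 * u - 2^-1 * v = w -> u = 2 * w + v.
  by move=> <-; field.
have double0 (u : R[i]) : u = - u -> u = 0.
  move=> uu; have two : 2 != 0 :> R[i] by rewrite pnatr_eq0.
  by apply: (mulfI two); rewrite mulr0 mulr_natl mulr2n {1}uu addNr.
split; [split|split|].
- by have := H i2 i2; rewrite r2 mxE /= subrr !mulr0 => /half; rewrite mulr0 sub0r => /double0.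
- by have := H i1 i1; rewrite r1 mxE /= subrr !mulr0 => /half; rewrite mulr0 sub0r => /double0.
- by have := H i4 i4; rewrite r4 mxE /= subrr !mulr0 => /halfN; rewrite mulr0 sub0r => /double0.
- by have := H i3 i3; rewrite r3 mxE /= subrr !mulr0 => /halfN; rewrite mulr0 sub0r => /double0.
- by have := H i1 i3; rewrite r1 r3 mxE /= subrr !mulr0 => /halfB; rewrite mulr0 add0r.
- by have := H i1 i4; rewrite r1 r4 mxE /= subrr !mulr0 => /halfB; rewrite mulr0 add0r.
- by have := H i2 i3; rewrite r2 r3 mxE /= subrr !mulr0 => /halfB; rewrite mulr0 add0r.
- by have := H i2 i4; rewrite r2 r4 mxE /= subrr !mulr0 => /halfB; rewrite mulr0 add0r.
- have := H i1 i2; rewrite r1 r2 mxE /= => /half ->.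
  by have := H i3 i4; rewrite r3 r4 mxE /= => /halfN ->; ring.
Qed.

End NullFrame.

(** * The exterior derivative of [E_L] on horizontal lifts *)

Section TwistorEquation.
Context {R : realType}.
Local Notation TS := (@twistor_space R).
Implicit Types (a b c : 'I_4) (x y : 'rV[R]_4) (u v w : 'rV[R[i]]_4).
Context (G : 'rV[R]_4 -> 'M[R]_4) (A : 'rV[R]_4 -> 'rV[R]_4).
Context (T : 'rV[R]_4 -> 'M[R[i]]_4) (Gam : 'I_4 -> 'I_4 -> 'rV[R]_4 -> 'rV[R[i]]_4).
Context (U : set 'rV[R]_4).
Hypothesis coframeT : coframe_on T U.
Hypothesis weylT : weyl_connection_on G A T Gam U.
Hypothesis nullT : forall x, U x -> null_cotetrad (G x) (T x).

Let oU : open U. Proof. by case: coframeT. Qed.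

Let nbhsU x : U x -> nbhs x U.
Proof. by move=> Ux; exact: (open_nbhs_nbhs (conj oU Ux)). Qed.

Let unitT x : U x -> T x \in unitmx.
Proof. by case: coframeT => _ _; apply. Qed.

(** A null cotetrad has constant metric components, so compatibility becomes an algebraic condition,
    with factor [t = A_a]. *)
Lemma conn_weyl_algebra x a : U x -> weyl_algebra (conn_mx Gam a x).
Proof.
move=> Ux; have fg y : U y -> frame_metric G T y = null_metric.
  by move=> Uy; apply: null_frame_metric; [exact: unitT|exact: nullT].
apply: (@null_metric_weyl_algebra _ _ (A x 0 a)%:C).
have := frame_metric_compat weylT a Ux.
rewrite (@near_eq_mderive _ _ _ _ _ (fun=> null_metric)); last first.
  by apply: filterS (nbhsU Ux) => y /fg.
rewrite (_ : mderive _ _ _ = 0); last first.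
  by apply/matrixP => i j; rewrite mxE [RHS]mxE cderive_cst.
by rewrite (fg x Ux) => /eqP; rewrite eq_sym subr_eq0 => /eqP.
Qed.

Lemma frame_curvature_weyl_algebra x a b : U x -> weyl_algebra (frame_curvature Gam a b x).
Proof.
move=> Ux; rewrite /frame_curvature -addrA; apply: weyl_algebraD; last first.
  by apply: weyl_algebra_comm; exact: conn_weyl_algebra.
have wd c d : weyl_algebra (mderive (basis_vec c) (conn_mx Gam d) x).
  apply: weyl_algebra_mderive; first exact: (conn_mdiff coframeT weylT d Ux).
  by apply: filterS (nbhsU Ux) => y; exact: conn_weyl_algebra.
by apply: weyl_algebraB.
Qed.

(** This and the next two definitions extend complex-linearly to complex vectors, because [mu^*] is
    not real. In [dconn_along] the vectors are constant and only the connection coefficients are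
    differentiated. *)
Definition conn_along u y : 'M[R[i]]_4 := \sum_a u 0 a *: conn_mx Gam a y.

Definition dconn_along u w y : 'M[R[i]]_4 :=
  \sum_a \sum_b (u 0 a * w 0 b) *: mderive (basis_vec a) (conn_mx Gam b) y.

Definition curvature_along u w y : 'M[R[i]]_4 :=
  \sum_a \sum_b (u 0 a * w 0 b) *: frame_curvature Gam a b y.

Lemma curvature_alongE u w y : curvature_along u w y =
  dconn_along u w y - dconn_along w u y +
  (conn_along u y *m conn_along w y - conn_along w y *m conn_along u y).
Proof.
have P (u' w' : 'rV[R[i]]_4) : conn_along u' y *m conn_along w' y =
    \sum_a \sum_b (u' 0 a * w' 0 b) *: (conn_mx Gam a y *m conn_mx Gam b y).
  rewrite /conn_along mulmx_suml; apply: eq_bigr => a _.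
  rewrite mulmx_sumr; apply: eq_bigr => b _.
  by rewrite -scalemxAl -scalemxAr scalerA.
have swap (F : 'I_4 -> 'I_4 -> 'M[R[i]]_4) : \sum_a \sum_b (w 0 a * u 0 b) *: F a b =
    \sum_a \sum_b (u 0 a * w 0 b) *: F b a.
  rewrite exchange_big; apply: eq_bigr => a _; apply: eq_bigr => b _.
  by rewrite mulrC.
rewrite !P /curvature_along /dconn_along !swap -!sumrB -big_split /=.
apply: eq_bigr => a _; rewrite -!sumrB -big_split /=; apply: eq_bigr => b _.
by rewrite -!scalerBr -scalerDr /frame_curvature addrA.
Qed.

Lemma form_of_row_conn i j y (v : 'rV[R]_4) :
  form_of_row (Gam i j) y (fun=> v) = conn_along (complexify v) y i j.
Proof.
rewrite /form_of_row /conn_along summxE; apply: eq_bigr => c _.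
by rewrite !mxE mulrC.
Qed.

Lemma form_of_row_conn_cdiff i j y (v : 'rV[R]_4) : U y ->
  cdiff (fun y => form_of_row (Gam i j) y (fun=> v)) y.
Proof.
move=> Uy; apply: cdiff_sum => c _; apply: cdiffM; last exact: cdiff_cst.
by have := conn_mdiff coframeT weylT c Uy i j; under eq_fun do rewrite mxE.
Qed.

Lemma form_of_row_conn_cderive i j y (u v : 'rV[R]_4) : U y ->
  cderive (fun y => form_of_row (Gam i j) y (fun=> v)) y u =
  dconn_along (complexify u) (complexify v) y i j.
Proof.
move=> Uy; rewrite cderive_row_sum; last exact: form_of_row_conn_cdiff.
rewrite /dconn_along summxE; apply: eq_bigr => a _.
rewrite summxE.
have cd c : cdiff (fun y => Gam i j y 0 c) y.
  by have := conn_mdiff coframeT weylT c Uy i j; under eq_fun do rewrite mxE.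
rewrite cderive_sum => [|c _]; last by apply: cdiffM => //; exact: cdiff_cst.
rewrite mulr_sumr; apply: eq_bigr => c _.
rewrite (cderiveM _ (cd c) (cdiff_cst _ _)).
rewrite cderive_cst mulr0 addr0 !mxE.
under [in RHS]eq_fun do rewrite mxE.
by rewrite mulrAC mulrA mulrAC.
Qed.

(* [E_L = dz + twistor_quadratic z Gamma]. *)
Definition twistor_quadratic (z : R[i]) (M : 'M[R[i]]_4) : R[i] :=
  - M i3 i2 + z * (M i1 i1 - M i4 i4) + z ^+ 2 * M i2 i3.

Lemma E_LE (q : TS) (W : 'I_1 -> TS) : E_L Gam q W =
  zcoord (W 0) + twistor_quadratic (zcoord q) (conn_along (complexify (W 0).1) q.1).
Proof.
rewrite /E_L /pullback /ext_d big_ord1 expr0 mul1r zcoord_cderive.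
rewrite (_ : (fun i => (W i).1) = (fun=> (W 0).1)); last first.
  by apply/funext => i; rewrite ord1.
by rewrite !form_of_row_conn /twistor_quadratic !addrA.
Qed.

(** The last summand is the fibre contribution: its bracket is the derivative of [twistor_quadratic]
    with respect to [z]. *)
Lemma cderive_E_L (q V W : TS) : U q.1 ->
  let g := conn_along (complexify W.1) q.1 in
  cderive (fun q' => E_L Gam q' (fun=> W)) q V =
  twistor_quadratic (zcoord q) (dconn_along (complexify V.1) (complexify W.1) q.1) +
  zcoord V * (g i1 i1 - g i4 i4 + 2 * zcoord q * g i2 i3).
Proof.
move=> Uq g.
pose f i j (q' : TS) := form_of_row (Gam i j) q'.1 (fun=> W.1).
have fc i j : cdiff (f i j) q.
  exact: (pullback_cdiff (form_of_row_conn_cdiff i j W.1 Uq)).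
have fd i j : cderive (f i j) q V = dconn_along (complexify V.1) (complexify W.1) q.1 i j.
  by rewrite -form_of_row_conn_cderive// -pullback_cderive.
have fg i j : f i j q = g i j by rewrite /f form_of_row_conn.
have zc := zcoord_cdiff q.
have -> : (fun q' => E_L Gam q' (fun=> W)) = (fun q' => zcoord W - f i3 i2 q' +
    zcoord q' * (f i1 i1 q' - f i4 i4 q') + (zcoord q' * zcoord q') * f i2 i3 q').
  apply/funext => q'.
  by rewrite /E_L /ext_d big_ord1 expr0 mul1r zcoord_cderive expr2.
have cW : cdiff (fun _ : TS => zcoord W) q := cdiff_cst _ _.
have c1 := cdiffB cW (fc i3 i2).
have c2 := cdiffB (fc i1 i1) (fc i4 i4).
have c3 := cdiffM zc c2.
have c4 := cdiffM zc zc.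
rewrite (cderiveD _ (cdiffD c1 c3) (cdiffM c4 (fc i2 i3))) (cderiveD _ c1 c3).
rewrite (cderiveB _ cW (fc i3 i2)) (cderiveM _ zc c2) (cderiveB _ (fc i1 i1) (fc i4 i4)).
rewrite (cderiveM _ c4 (fc i2 i3)) (cderiveM _ zc zc) cderive_cst.
rewrite zcoord_cderive !fd !fg /twistor_quadratic; ring.
Qed.

(* The lift of [u] to the kernel of [E_L]. *)
Definition horizontal y (z : R[i]) (u : 'rV[R]_4) : TS :=
  twistor_pt u (- twistor_quadratic z (conn_along (complexify u) y)).

Lemma zcoord_pt y (z : R[i]) : zcoord (twistor_pt y z) = z.
Proof. by case: z. Qed.

(** Write [q] for the quadratic and [q'] for its derivative in [z]. The vertical parts of the lifts
    contribute [q(N) q'(M) - q(M) q'(N)], where [M], [N] are the connection along [u], [w]; for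
    conformal matrices this equals [q(M N - N M)], the commutator term of the curvature. The lifts
    are frozen at the base point, as constant fields for [ext_d]. *)
Lemma ext_d_E_L_horizontal y z (u w : 'rV[R]_4) : U y ->
  ext_d (E_L Gam) (twistor_pt y z)
    (fun s : 'I_2 => if s == 0 then horizontal y z u else horizontal y z w) =
  twistor_quadratic z (curvature_along (complexify u) (complexify w) y).
Proof.
move=> Uy; rewrite ext_d1 /= !cderive_E_L//= !zcoord_pt curvature_alongE.
have wa v : weyl_algebra (conn_along v y).
  by apply: weyl_algebra_sum => a; apply: weyl_algebraZ; exact: conn_weyl_algebra.
move: (wa (complexify u)) (wa (complexify w)).
move: (conn_along _ _) (conn_along _ _) => M N.
move=> [[m1 m2 m3 m4] [m5 m6 m7 m8] m9] [[n1 n2 n3 n4] [n5 n6 n7 n8] n9].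
rewrite /twistor_quadratic !mxE !sum4.
rewrite ?m1 ?m2 ?m3 ?m4 ?n1 ?n2 ?n3 ?n4 ?m5 ?m6 ?m7 ?m8 ?n5 ?n6 ?n7 ?n8 ?m9 ?n9; ring.
Qed.

End TwistorEquation.

(** * Reality *)

Section Reality.
Context {R : realType}.
Implicit Types (a b c : 'I_4) (x y : 'rV[R]_4).

Lemma conjcM (k l : R[i]) : conjc (k * l) = conjc k * conjc l.
Proof. exact: rmorphM. Qed.

Lemma conjcD (k l : R[i]) : conjc (k + l) = conjc k + conjc l.
Proof. exact: rmorphD. Qed.

Lemma conjcN (k : R[i]) : conjc (- k) = - conjc k.
Proof. exact: rmorphN. Qed.

Lemma conjcB (k l : R[i]) : conjc (k - l) = conjc k - conjc l.
Proof. exact: rmorphB. Qed.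

Lemma conjc_half : conjc (2^-1 : R[i]) = 2^-1.
Proof. by rewrite conjc_inv conjc_nat. Qed.

Lemma conjc_i : conjc 'i%C = - 'i%C :> R[i].
Proof. by apply/eqP; rewrite eq_complex /= oppr0 !eqxx. Qed.

Definition is_realmx {m n} (M : 'M[R[i]]_(m, n)) := map_mx (@conjc R) M = M.

Lemma realmx_complexify m n (B : 'M[R]_(m, n)) : is_realmx (complexify B).
Proof. by apply/matrixP => i j; rewrite !mxE conjc_real. Qed.

Lemma realmxD m n (M N : 'M[R[i]]_(m, n)) : is_realmx M -> is_realmx N -> is_realmx (M + N).
Proof. by move=> rM rN; rewrite /is_realmx map_mxD rM rN. Qed.

Lemma realmxB m n (M N : 'M[R[i]]_(m, n)) : is_realmx M -> is_realmx N -> is_realmx (M - N).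
Proof. by move=> rM rN; rewrite /is_realmx map_mxB rM rN. Qed.

Lemma realmx_mul m n p (M : 'M[R[i]]_(m, n)) (N : 'M[R[i]]_(n, p)) :
  is_realmx M -> is_realmx N -> is_realmx (M *m N).
Proof. by move=> rM rN; rewrite /is_realmx map_mxM rM rN. Qed.

Lemma realmxZ m n (k : R) (M : 'M[R[i]]_(m, n)) : is_realmx M -> is_realmx (k%:C *: M).
Proof. by move=> rM; rewrite /is_realmx map_mxZ rM; congr (_ *: _); exact: conjc_real. Qed.

Lemma realmx_sum m n (I : Type) (r : seq I) (F : I -> 'M[R[i]]_(m, n)) :
  (forall i, is_realmx (F i)) -> is_realmx (\sum_(i <- r) F i).
Proof.
move=> rF; elim: r => [|i r IH]; first by rewrite /is_realmx big_nil map_mx0.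
by rewrite big_cons; apply: realmxD.
Qed.

Lemma realmx_inv n (M : 'M[R[i]]_n) : is_realmx M -> is_realmx (invmx M).
Proof. by move=> rM; rewrite /is_realmx map_invmx rM. Qed.

Lemma realmx_mderive {V : normedModType R} m n (F : V -> 'M[R[i]]_(m, n)) (x v : V) :
  (forall p, is_realmx (F p)) -> is_realmx (mderive v F x).
Proof.
move=> rF; apply/matrixP => i j; rewrite !mxE /cderive.
have -> : (fun p => complex.Im (F p i j)) = cst 0.
  apply/funext => p; have /matrixP/(_ i j) := rF p; rewrite mxE.
  by case: (F p i j) => s t /= [] /eqP; rewrite eq_sym -addr_eq0 -mulr2n mulrn_eq0 => /eqP.
by rewrite derive_cst; exact: conjc_real.
Qed.

(** Koszul's formula only involves the real data [G] and [A]. The statement holds at every point,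
    inside the chart or not, which is the form that [realmx_mderive] requires for the next
    derivative. *)
Lemma christoffel_real G A a x : is_realmx (@christoffel R G A a x).
Proof.
have rX c y : is_realmx (metric_weyl_derivative G A c y).
  apply: realmxD; last by apply: realmxZ; exact: realmx_complexify.
  by apply: realmx_mderive => w; exact: realmx_complexify.
apply: realmx_mul; first by apply: realmx_inv; exact: realmx_complexify.
have rE c i j : conjc (metric_weyl_derivative G A c x i j) =
    metric_weyl_derivative G A c x i j.
  by rewrite -[in RHS](rX c x) [RHS]mxE.
apply/matrixP => i j; rewrite [LHS]mxE [in LHS]mxE [RHS]mxE.
rewrite rmorphM rmorphB rmorphD /= !rE.
by congr (_ * _); exact: conjc_half.
Qed.

Lemma coord_curvature_real G A a b x : is_realmx (@coord_curvature R G A a b x).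
Proof.
have rC := @christoffel_real G A.
have rd c d : is_realmx (mderive (basis_vec c) (christoffel G A d) x).
  by apply: realmx_mderive.
by apply: realmxB; [apply: realmxD; [exact: realmxB|]|]; apply: realmx_mul.
Qed.

Definition conj_label (i : 'I_4) : 'I_4 := if i == i1 then i2 else if i == i2 then i1 else i.

Lemma null_cotetrad_conj (G : 'M[R]_4) (T : 'M[R[i]]_4) i a : null_cotetrad G T ->
  conjc (T i a) = T (conj_label i) a.
Proof.
move=> [MP NK _ _]; move: i; apply: ord4_ind => //=.
- by rewrite -MP conjcK.
- by have [+ _] := NK a; rewrite /conj_label /=; case: (T i3 a) => p q /= ->; rewrite oppr0.
- by have [_ +] := NK a; rewrite /conj_label /=; case: (T i4 a) => p q /= ->; rewrite oppr0.
Qed.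

Definition frame_coord (T : 'M[R[i]]_4) (u : 'rV[R[i]]_4) (i : 'I_4) : R[i] :=
  (T *m u^T) i 0.

Lemma frame_coord_conj (G : 'M[R]_4) T u i : null_cotetrad G T ->
  frame_coord T (map_mx (@conjc R) u) i = conjc (frame_coord T u (conj_label i)).
Proof.
move=> nT; rewrite /frame_coord !mxE rmorph_sum; apply: eq_bigr => a _.
rewrite !mxE rmorphM /= (null_cotetrad_conj _ _ nT); congr (T _ _ * _).
by move: i; apply: ord4_ind.
Qed.

Lemma frame_coord_inj T u v : T \in unitmx -> frame_coord T u =1 frame_coord T v -> u = v.
Proof.
move=> uT E; apply: trmx_inj; rewrite -(mulKmx uT u^T) -(mulKmx uT v^T); congr (_ *m _).
by apply/matrixP => i j; rewrite ord1; exact: E.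
Qed.

Lemma frame_coordD T u v i : frame_coord T (u + v) i = frame_coord T u i + frame_coord T v i.
Proof. by rewrite /frame_coord linearD /= mulmxDr mxE. Qed.

Lemma frame_coordZ T k u i : frame_coord T (k *: u) i = k * frame_coord T u i.
Proof. by rewrite /frame_coord linearZ /= -scalemxAr mxE. Qed.

Lemma frame_coord_lin (T : 'M[R[i]]_4) k l u v i : frame_coord T (k *: u + l *: v) i =
  k * frame_coord T u i + l * frame_coord T v i.
Proof. by rewrite frame_coordD 2!frame_coordZ. Qed.

Lemma frame_coord_onto T (t : 'I_4 -> R[i]) : T \in unitmx ->
  exists u, frame_coord T u =1 t.
Proof.
move=> uT; exists (invmx T *m \col_i t i)^T => i.
by rewrite /frame_coord trmxK mulKVmx// mxE.
Qed.

(** Forms are evaluated on real vectors only. This produces test vectors from prescribed complex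
    components, subject to the reality condition that conjugation exchanges the labels 1 and 2. *)
Lemma real_of_frame (G : 'M[R]_4) T (t : 'I_4 -> R[i]) : null_cotetrad G T ->
  T \in unitmx -> (forall i, conjc (t i) = t (conj_label i)) ->
  exists u : 'rV[R]_4, frame_coord T (complexify u) =1 t.
Proof.
move=> nT uT ct; have [u ut] := frame_coord_onto t uT.
have ru : is_realmx u.
  apply: (frame_coord_inj uT) => i; rewrite (frame_coord_conj _ _ nT) ut.
  by rewrite ct ut; move: i; apply: ord4_ind.
exists (map_mx (@complex.Re R) u).
suff -> : complexify (map_mx (@complex.Re R) u) = u by [].
apply/matrixP => i j; rewrite !mxE; have /matrixP/(_ i j) := ru; rewrite mxE.
case: (u i j) => p q /= [] /eqP; rewrite eq_sym -addr_eq0 -mulr2n mulrn_eq0 => /eqP ->.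
by [].
Qed.

Lemma theta_frame_coord (T : 'rV[R]_4 -> 'M[R[i]]_4) i x (u : 'rV[R]_4) (f : 'I_1 -> 'rV[R]_4) :
  f 0 = u -> theta T i x f = frame_coord (T x) (complexify u) i.
Proof.
move=> fu; rewrite /theta /form_of_row /frame_coord mxE; apply: eq_bigr => c _.
by rewrite !mxE fu.
Qed.

End Reality.

(** * The equation at a point of the twistor bundle *)

Section NullRicci.
Context {R : realType}.
Local Notation TS := (@twistor_space R).
Implicit Types (a b c : 'I_4) (x y : 'rV[R]_4).
Context (G : 'rV[R]_4 -> 'M[R]_4) (A : 'rV[R]_4 -> 'rV[R]_4).
Context (T : 'rV[R]_4 -> 'M[R[i]]_4) (Gam : 'I_4 -> 'I_4 -> 'rV[R]_4 -> 'rV[R[i]]_4).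
Context (U : set 'rV[R]_4).
Hypothesis coframeT : coframe_on T U.
Hypothesis weylT : weyl_connection_on G A T Gam U.
Hypothesis nullT : forall x, U x -> null_cotetrad (G x) (T x).
Hypothesis smoothG : forall x, U x -> mdiff (fun y => complexify (G y)) x.
Hypothesis symG : forall x, U x -> (G x)^T = G x.
Hypothesis unitG : forall x, U x -> G x \in unitmx.
Context (y : 'rV[R]_4) (z : R[i]).
Hypothesis Uy : U y.
Hypothesis invariant0 : forall v, invariant_form T Gam (twistor_pt y z) v = 0.

Let uT : T y \in unitmx. Proof. by case: coframeT => _ _; apply. Qed.
Let nT : null_cotetrad (G y) (T y). Proof. exact: nullT. Qed.

(* Components of [k - z m - z^* p + z z^* n]. *)
Definition null_coord (i : 'I_4) : R[i] := nth 0 [:: - z; - conjc z; z * conjc z; 1] i.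

Lemma twistor_quadraticD (M N : 'M[R[i]]_4) k :
  twistor_quadratic z (M + k *: N) = twistor_quadratic z M + k * twistor_quadratic z N.
Proof. by rewrite /twistor_quadratic !mxE; ring. Qed.

Lemma curvature_along_linear p q r k :
  curvature_along Gam p (q + k *: r) y = curvature_along Gam p q y + k *: curvature_along Gam p r y.
Proof.
rewrite /curvature_along scaler_sumr -big_split; apply: eq_bigr => a _.
rewrite scaler_sumr -big_split; apply: eq_bigr => b _.
by rewrite !mxE mulrDr scalerDl scalerA; congr (_ + _ *: _); ring.
Qed.

Lemma curvature_along_swap p q :
  curvature_along Gam p q y = - curvature_along Gam q p y.
Proof.
rewrite /curvature_along exchange_big -sumrN; apply: eq_bigr => a _.
rewrite -sumrN; apply: eq_bigr => b _; rewrite -scalerN mulrC; congr (_ *: _).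
have swap (W : zmodType) (k l r s : W) : k - l + r - s = - (l - k + s - r).
  by rewrite !opprD !opprK [- l + k]addrC addrAC.
exact: swap.
Qed.

(** [X] is the real null vector [l], and [b], [c] are the real vectors with [b - 'i *: c = mu^*],
    the direction on which the conjugate of [F_L] vanishes. *)
Lemma invariant_curvature (X b c n : 'rV[R]_4) :
  frame_coord (T y) (complexify X) =1 null_coord ->
  frame_coord (T y) (complexify b) =1
    (fun i => nth 0 [:: - 2^-1; - 2^-1; (complex.Re z)%:C; 0] i) ->
  frame_coord (T y) (complexify c) =1
    (fun i => nth 0 [:: - 2^-1 * 'i%C; 2^-1 * 'i%C; (complex.Im z)%:C; 0] i) ->
  frame_coord (T y) (complexify n) =1 (fun i => nth 0 [:: 0; 0; 1; 0] i) ->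
  twistor_quadratic z
    (curvature_along Gam (complexify X) (complexify b - 'i%C *: complexify c) y) = 0.
Proof.
move=> EX Eb Ec En.
pose q : TS := twistor_pt y z.
pose h := horizontal Gam y z.
(* Four horizontal lifts, killed by [E_L], and the vertical vector along Re z, on which [E_L] is 1.
   Among the lifts [Lambda_L] kills those of [X], [b], [c] and is -1 on that of [n]; the conjugate
   of [F_L] kills that of [X]. *)
pose v (i : 'I_5) : TS := nth 0 [:: h X; h b; h c; h n; ((0 : 'rV[R]_4), (1, 0))] i.
have Eh u : E_L Gam q (fun=> h u) = 0.
  by rewrite E_LE /h zcoord_pt /= zcoord_pt addNr.
have Ev : E_L Gam q (fun=> v ord_max) = 1.
  rewrite E_LE /v /= /twistor_quadratic.
  have -> : conn_along Gam (complexify 0) y = 0.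
    by rewrite /conn_along big1// => a _; rewrite !mxE scale0r.
  have -> : @zcoord R ((0 : 'rV[R]_4), (1, 0)) = 1 by [].
  by rewrite !mxE; ring.
have th i u : pullback (theta T i) q (fun=> h u) = frame_coord (T y) (complexify u) i.
  exact: theta_frame_coord.
have ii : 'i%C * 'i%C = -1 :> R[i] by rewrite -expr2 sqr_i.
have LE u : Lambda_L T q (fun=> h u) = let f := frame_coord (T y) (complexify u) in
    - f i3 - z * conjc z * f i4 - z * f i2 - conjc z * f i1.
  by rewrite /Lambda_L zcoord_pt !th.
have FE u : form_conj (F_L T) q (fun=> h u) = let f := frame_coord (T y) (complexify u) in
    conjc (f i1 + z * f i4).
  by rewrite /form_conj /F_L zcoord_pt !th.
have LX : Lambda_L T q (fun=> h X) = 0.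
  by rewrite LE /= !EX /null_coord /=; ring.
have Lb : Lambda_L T q (fun=> h b) = 0.
  rewrite LE /= !Eb /=.
  transitivity (2^-1 * (z + conjc z) - (complex.Re z)%:C); first by field.
  by rewrite addcJ; field.
have Lc : Lambda_L T q (fun=> h c) = 0.
  rewrite LE /= !Ec /=.
  transitivity (- (2^-1 * 'i%C * (z - conjc z)) - (complex.Im z)%:C); first by field.
  rewrite subcJ; transitivity (- ('i%C * 'i%C) * (complex.Im z)%:C - (complex.Im z)%:C); first by field.
  by rewrite ii; ring.
have Ln : Lambda_L T q (fun=> h n) = -1.
  by rewrite LE /= !En /=; ring.
have FX : form_conj (F_L T) q (fun=> h X) = 0.
  by rewrite FE /= !EX /null_coord /= mulr1 addNr conjc0.
have Fb : form_conj (F_L T) q (fun=> h b) = - 2^-1.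
  rewrite FE /= !Eb /= mulr0 addr0.
  by rewrite conjcN conjc_half.
have Fc : form_conj (F_L T) q (fun=> h c) = 2^-1 * 'i%C.
  rewrite FE /= !Ec /= mulr0 addr0.
  by rewrite conjcM conjcN conjc_half conjc_i mulrNN.
have := invariant0 v; rewrite /invariant_form.
rewrite wedge_last; [|exact: wedge_alternating|]; last first.
  by apply: ord4_ind; exact: Eh.
rewrite [X in _ * X = _](_ : _ = 1) ?mulr1; last first.
  by rewrite -Ev; congr (E_L _ _ _); apply/funext => _; congr v; apply: val_inj.
rewrite wedge_last; [|exact: wedge_alternating|]; last first.
  by case=> [[|[|[|//]]] p]; [exact: LX|exact: Lb|exact: Lc].
rewrite [X in _ * X = _](_ : _ = -1); last first.
  by rewrite -Ln.
rewrite (@wedge21 _ _ _ _ _ (h X) (h b) (h c)) //; last exact: ext_d1_alternating.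
rewrite Fb Fc !(ext_d_E_L_horizontal coframeT weylT nullT)//.
move=> E; have -> : complexify b - 'i%C *: complexify c = complexify b + (- 'i%C) *: complexify c.
  by rewrite scaleNr.
rewrite curvature_along_linear twistor_quadraticD.
(* The surviving expression is [-'i / 2] times the value on [b - 'i *: c]; the factor [2 'i]
   normalises it. *)
rewrite -[RHS](mulr0 (2 * 'i%C)) -E.
move: (twistor_quadratic _ _) (twistor_quadratic _ _) => l k.
by transitivity (- ('i%C * 'i%C) * k - 'i%C * l); [rewrite ii; ring|field].
Qed.

Definition coord_curvature_row (X : 'rV[R]_4) a : 'cV[R[i]]_4 :=
  \sum_b (complexify X 0 b *: coord_curvature G A a b y *m (complexify X)^T).

Lemma coord_curvature_row_real X a : is_realmx (coord_curvature_row X a).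
Proof.
apply: realmx_sum => b; apply: realmx_mul.
  by rewrite mxE; apply: realmxZ; exact: coord_curvature_real.
by rewrite /is_realmx -map_trmx; congr (_^T); exact: realmx_complexify.
Qed.

(* [u |-> R(u, X) X] *)
Definition tidal (X : 'rV[R]_4) (u : 'rV[R[i]]_4) : 'cV[R[i]]_4 :=
  \sum_a u 0 a *: coord_curvature_row X a.

Lemma tidal_linear X u w k : tidal X (u + k *: w) = tidal X u + k *: tidal X w.
Proof.
rewrite /tidal scaler_sumr -big_split; apply: eq_bigr => a _.
by rewrite !mxE scalerDl scalerA.
Qed.

Lemma tidal_conj X u : tidal X (map_mx (@conjc R) u) = map_mx (@conjc R) (tidal X u).
Proof.
apply/matrixP => i j; rewrite [RHS]mxE !summxE rmorph_sum; apply: eq_bigr => a _.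
rewrite !mxE rmorphM /=; congr (_ * _).
by rewrite -[in LHS](coord_curvature_row_real X a) mxE.
Qed.

(** [tidal] is built in coordinates, where it commutes with conjugation; this carries it to the null
    frame, where the curvature is conformal. *)
Lemma tidal_frame X u : T y *m tidal X u =
  curvature_along Gam u (complexify X) y *m (T y *m (complexify X)^T).
Proof.
rewrite /tidal /curvature_along mulmx_sumr mulmx_suml; apply: eq_bigr => a _.
rewrite -scalemxAr /coord_curvature_row mulmx_sumr mulmx_suml scaler_sumr.
apply: eq_bigr => b _.
have move_frame (k t r : 'M[R[i]]_4) (l : 'cV[R[i]]_4) p q : k *m t = t *m r ->
    p *: (t *m (q *: r *m l)) = ((p * q) *: k) *m (t *m l).
  by move=> E; rewrite -[RHS]scalemxAl [in RHS]mulmxA E -scalemxAl -scalemxAr scalerA mulmxA.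
exact: move_frame (frame_curvatureE coframeT weylT smoothG symG unitG a b Uy).
Qed.

Lemma tidal_self X : tidal X (complexify X) = 0.
Proof.
have : T y *m tidal X (complexify X) = 0.
  have E : T y *m tidal X (complexify X) = - (T y *m tidal X (complexify X)).
    by rewrite {1}tidal_frame curvature_along_swap mulNmx -tidal_frame.
  apply/eqP; have : 2%:R *: (T y *m tidal X (complexify X)) = 0.
    by rewrite scaler_nat mulr2n {1}E addNr.
  by move/eqP; rewrite scaler_eq0 pnatr_eq0.
by move=> E; rewrite -(mulKmx uT (tidal _ _)) E mulmx0.
Qed.

(** Ric(X, X) is the trace of [tidal X]; inserting the product of the inverse of [T] with [T]
    between the indices moves the trace from the coordinate frame to the null frame. *)
Lemma tidal_trace (X : 'rV[R]_4) :
  (complexify X *m coord_ricci G A y *m (complexify X)^T) 0 0 =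
  \sum_k (T y *m tidal X (dual_vec T y k)) k 0.
Proof.
transitivity (\sum_a coord_curvature_row X a a 0).
  rewrite mxE; under eq_bigr do rewrite mxE mulr_suml.
  transitivity (\sum_b \sum_c \sum_a
      complexify X 0 b * (coord_curvature G A a b y a c * complexify X 0 c)).
    apply: eq_bigr => b _; apply: eq_bigr => c _.
    rewrite [coord_ricci _ _ _ _ _]mxE [(complexify X)^T _ _]mxE mulr_sumr mulr_suml.
    by apply: eq_bigr => a _; ring.
  under eq_bigr do rewrite exchange_big /=.
  rewrite exchange_big /=; apply: eq_bigr => a _.
  rewrite summxE; apply: eq_bigr => b _.
  rewrite -scalemxAl [RHS]mxE [X in _ = _ * X]mxE mulr_sumr; apply: eq_bigr => c _.
  by rewrite [(complexify X)^T _ _]mxE.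
transitivity (\sum_a \sum_d (1%:M : 'M[R[i]]_4) a d * coord_curvature_row X a d 0).
  apply: eq_bigr => a _; rewrite (bigD1 a)//= big1 => [|d da].
    by rewrite mxE eqxx mul1r addr0.
  by rewrite mxE eq_sym (negbTE da) mul0r.
rewrite -(mulVmx uT).
transitivity (\sum_a \sum_d \sum_k
    T y k d * (invmx (T y) a k * coord_curvature_row X a d 0)).
  apply: eq_bigr => a _; apply: eq_bigr => d _; rewrite mxE mulr_suml.
  by apply: eq_bigr => k _; ring.
under eq_bigr do rewrite exchange_big /=.
rewrite exchange_big /=; apply: eq_bigr => k _.
rewrite exchange_big /= mxE; apply: eq_bigr => d _.
rewrite /tidal summxE mulr_sumr; apply: eq_bigr => a _.
by rewrite !mxE.
Qed.

(** The left-hand sides are [F_L] and [-Lambda_L] on [M l]. The first identity thus reads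
    [twistor_quadratic z M = 2 g(mu, M l)], and the second is [g(l, M l) = 0], valid for a null
    vector and a conformal matrix. *)
Lemma weyl_algebra_null_coord (M : 'M[R[i]]_4) (l : 'cV[R[i]]_4) : weyl_algebra M ->
  (forall i, l i 0 = null_coord i) ->
  (M *m l) i1 0 + z * (M *m l) i4 0 = - twistor_quadratic z M /\
  conjc z * (M *m l) i1 0 + z * (M *m l) i2 0 + (M *m l) i3 0
    + z * conjc z * (M *m l) i4 0 = 0.
Proof.
move=> [[m1 m2 m3 m4] [m5 m6 m7 m8] m9] El.
rewrite !mxE !sum4 !El /null_coord /= /twistor_quadratic.
by rewrite ?m1 ?m2 ?m3 ?m4 ?m5 ?m6 ?m7 ?m8 ?m9; split; ring.
Qed.

Lemma ricci_null (X : 'rV[R]_4) :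
  frame_coord (T y) (complexify X) =1 null_coord ->
  (complexify X *m coord_ricci G A y *m (complexify X)^T) 0 0 = 0.
Proof.
move=> EX.
have [|b Eb] := @real_of_frame _ _ (T y)
    (fun i => nth 0 [:: - 2^-1; - 2^-1; (complex.Re z)%:C; 0] i) nT uT.
  apply: ord4_ind.
  - by rewrite [LHS]conjcN conjc_half.
  - by rewrite [LHS]conjcN conjc_half.
  - exact: conjc_real.
  - exact: conjc0.
have [|c Ec] := @real_of_frame _ _ (T y)
    (fun i => nth 0 [:: - 2^-1 * 'i%C; 2^-1 * 'i%C; (complex.Im z)%:C; 0] i) nT uT.
  apply: ord4_ind.
  - by rewrite [LHS]conjcM conjcN conjc_half conjc_i mulrNN.
  - by rewrite [LHS]conjcM conjc_half conjc_i mulrN -mulNr.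
  - exact: conjc_real.
  - exact: conjc0.
have [|n En] := @real_of_frame _ _ (T y) (fun i => nth 0 [:: 0; 0; 1; 0] i) nT uT.
  by apply: ord4_ind; [exact: conjc0|exact: conjc0|exact: conjc1|exact: conjc0].
have Q0 := invariant_curvature EX Eb Ec En.
pose e := dual_vec T y.
have Ee k i : frame_coord (T y) (e k) i = (i == k)%:R.
  have /matrixP/(_ i k) := mulmxV uT; rewrite [RHS]mxE mxE => <-.
  by rewrite /frame_coord /e /dual_vec trmxK mxE; apply: eq_bigr => a _; rewrite mxE.
have E12 : map_mx (@conjc R) (e i1) = e i2.
  apply: (frame_coord_inj uT) => i; rewrite (frame_coord_conj _ _ nT) !Ee conjc_nat.
  by congr (nat_of_bool _)%:R; move: i; apply: ord4_ind.
have E3 : map_mx (@conjc R) (e i3) = e i3.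
  apply: (frame_coord_inj uT) => i; rewrite (frame_coord_conj _ _ nT) !Ee conjc_nat.
  by congr (nat_of_bool _)%:R; move: i; apply: ord4_ind.
have ii : 'i%C * 'i%C = -1 :> R[i] by rewrite -expr2 sqr_i.
have conjE (w : R[i]) : conjc w = (complex.Re w)%:C - 'i%C * (complex.Im w)%:C.
  by case: w => r s; apply/eqP; rewrite eq_complex /=; apply/andP; split; apply/eqP; ring.
have Emu : complexify b + (- 'i%C) *: complexify c = -1 *: (e i1 + (- conjc z) *: e i3).
  apply: (frame_coord_inj uT) => i.
  rewrite !(frame_coordD, frame_coordZ) Eb Ec !Ee.
  move: i; apply: ord4_ind => /=.
  - by transitivity (- 2^-1 + 'i%C * 'i%C * 2^-1 : R[i]); [ring|rewrite ii; field].
  - by transitivity (- 2^-1 - 'i%C * 'i%C * 2^-1 : R[i]); [ring|rewrite ii; field].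
  - by rewrite conjE; ring.
  - by ring.
have EXe : complexify X = e i4 + (- z) *: e i1 + (- conjc z) *: e i2 + (z * conjc z) *: e i3.
  apply: (frame_coord_inj uT) => i; rewrite !(frame_coordD, frame_coordZ) EX !Ee.
  by move: i; apply: ord4_ind; rewrite /null_coord /=; ring.
pose t k i := (T y *m tidal X (e k)) i 0.
have tl (r s : 'cV[R[i]]_4) k i :
    (T y *m (r + k *: s)) i 0 = (T y *m r) i 0 + k * (T y *m s) i 0.
  by rewrite mulmxDr -scalemxAr mxE [X in _ + X]mxE.
have tc (s : 'cV[R[i]]_4) i :
    (T y *m map_mx (@conjc R) s) i 0 = conjc ((T y *m s) (conj_label i) 0).
  have := frame_coord_conj s^T i nT; rewrite /frame_coord trmxK => <-.
  by congr ((_ *m _) _ _); apply/matrixP => k l; rewrite !mxE.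
have t12 i : t i2 i = conjc (t i1 (conj_label i)) by rewrite /t -E12 tidal_conj tc.
have t33 i : t i3 i = conjc (t i3 (conj_label i)) by rewrite {1}/t -E3 tidal_conj tc.
(* Since [tidal X] kills [X], its value on [k] is a combination of its values on [m], [p], [n]. *)
have t4 i : t i4 i = z * t i1 i + conjc z * t i2 i - z * conjc z * t i3 i.
  have := tidal_self X; rewrite [in tidal _ _]EXe !tidal_linear.
  move=> /(congr1 (fun M => (T y *m M) i 0)).
  rewrite mulmx0 !tl [X in _ = X -> _]mxE -!/(t _ _).
  move: (t i1 i) (t i2 i) (t i3 i) (t i4 i) => r1 r2 r3 r4 E.
  by rewrite -[LHS]subr0 -E; ring.
have wa u : weyl_algebra (curvature_along Gam u (complexify X) y).
  do 2 (apply: weyl_algebra_sum => ?); apply: weyl_algebraZ.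
  exact: (frame_curvature_weyl_algebra coframeT weylT nullT).
have lE : forall i, (T y *m (complexify X)^T) i 0 = null_coord i by exact: EX.
have [_ H4] := weyl_algebra_null_coord (wa (e i3)) lE.
have [H2 _] := weyl_algebra_null_coord (wa (e i1 + (- conjc z) *: e i3)) lE.
rewrite -!tidal_frame -!/(t _ _) in H4.
have c0 : curvature_along Gam (complexify X) 0 y = 0.
  rewrite /curvature_along big1// => a _; rewrite big1// => d _.
  by rewrite [(0 : 'rV[R[i]]_4) 0 d]mxE mulr0 scale0r.
(* Two signs cancel: [b - 'i *: c] is minus [m - z^* n], and the arguments of the curvature are
   exchanged. *)
have Ecurv : curvature_along Gam (e i1 + (- conjc z) *: e i3) (complexify X) y =
    curvature_along Gam (complexify X) (complexify b - 'i%C *: complexify c) y.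
  rewrite -scaleNr Emu.
  have := curvature_along_linear (complexify X) 0 (e i1 + (- conjc z) *: e i3) (-1).
  by rewrite add0r c0 add0r => ->; rewrite scaleN1r; exact: curvature_along_swap.
rewrite -!tidal_frame tidal_linear Ecurv Q0 oppr0 !tl in H2.
rewrite -!/(t _ _) in H2.
have {}H2 : t i1 i1 - conjc z * t i3 i1 + z * (t i1 i4 - conjc z * t i3 i4) = 0.
  by rewrite -[RHS]H2; ring.
(* The conjugate of [H2], because [tidal X] is real and conjugation exchanges [m] and [p]. *)
have H3 : t i2 i2 - z * t i3 i2 + conjc z * (t i2 i4 - z * t i3 i4) = 0.
  rewrite !t12 (t33 i2) (t33 i4) /conj_label /= -[in LHS](conjcK z).
  rewrite -!(conjcM, conjcB, conjcD) conjcK H2; exact: conjc0.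
rewrite tidal_trace sum4 -!/(t _ _) t4.
(* The trace regrouped along [m - z^* n], [p - z n] and [n], paired with [F_L], its conjugate and
   [-Lambda_L]. *)
transitivity ((t i1 i1 - conjc z * t i3 i1 + z * (t i1 i4 - conjc z * t i3 i4)) +
   (t i2 i2 - z * t i3 i2 + conjc z * (t i2 i4 - z * t i3 i4)) +
   (conjc z * t i3 i1 + z * t i3 i2 + t i3 i3 + z * conjc z * t i3 i4)); first by ring.
by rewrite H2 H3 H4 !addr0.
Qed.

End NullRicci.

(** * Quadratic forms vanishing on the null cone *)

Section LorentzAlgebra.
Context {R : realType}.

Definition minkowski : 'M[R]_4 := diag_mx (\row_i (if i == i4 then -1 else 1)).

Lemma lorentzian_sym (G : 'M[R]_4) : lorentzian G -> G^T = G.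
Proof. by move=> [B _ ->]; rewrite !trmx_mul trmxK tr_diag_mx mulmxA. Qed.

Lemma minkowski_unit : minkowski \in unitmx.
Proof.
rewrite unitmxE det_diag unitfE; apply/prodf_neq0 => i _; rewrite mxE.
by case: ifP; rewrite ?oppr_eq0 oner_eq0.
Qed.

Lemma lorentzian_unit (G : 'M[R]_4) : lorentzian G -> G \in unitmx.
Proof.
move=> [B uB ->]; rewrite !unitmx_mul unitmx_tr uB /= andbT; exact: minkowski_unit.
Qed.

(** Reflecting the first coordinate preserves [minkowski] and flips the determinant. Positivity
    serves the orientation condition in [null_cotetrad]. *)
Lemma lorentzian_det_gt0 (G : 'M[R]_4) : lorentzian G ->
  exists2 B : 'M[R]_4, 0 < \det B & G = B^T *m minkowski *m B.
Proof.
move=> [B uB ->]; have [dB|dB|dB] := ltgtP (\det B) 0; first last.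
- by move: uB; rewrite unitmxE dB unitr0.
- by exists B.
pose J : 'M[R]_4 := diag_mx (\row_i (if i == i1 then -1 else 1)).
exists (J *m B).
  rewrite det_mulmx det_diag.
  have -> : \prod_(i < 4) (\row_i (if i == i1 then -1 else 1 : R)) 0 i = -1.
    rewrite (bigD1 i1)//= big1 ?mulr1 => [|i i0]; rewrite mxE ?eqxx//.
    by rewrite (negbTE i0).
  by rewrite mulN1r oppr_gt0.
rewrite trmx_mul tr_diag_mx -!mulmxA; congr (_ *m _); rewrite !mulmxA; congr (_ *m _).
rewrite /minkowski !mulmx_diag; congr diag_mx; apply/matrixP => i j; rewrite !mxE.
by case: (j == i1); case: (j == i4) => /=; ring.
Qed.

(* [e1 + i e2], [e1 - i e2], [e3 + e4], [e4 - e3] *)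
Definition null_rows : 'M[R[i]]_4 := \matrix_(i, j) nth 0 (nth [::]
  [:: [:: 1; 'i%C; 0; 0]; [:: 1; - 'i%C; 0; 0]; [:: 0; 0; 1; 1]; [:: 0; 0; -1; 1]] i) j.

Lemma det_null_rows : \det null_rows = - 4 * 'i%C.
Proof.
pose A : 'M[R[i]]_2 := \matrix_(i, j) nth 0 (nth [::] [:: [:: 1; 'i%C]; [:: 1; - 'i%C]] i) j.
pose D : 'M[R[i]]_2 := \matrix_(i, j) nth 0 (nth [::] [:: [:: 1; 1]; [:: -1; 1]] i) j.
have det2 (M : 'M[R[i]]_2) : \det M = M 0 0 * M 1 1 - M 0 1 * M 1 0.
  have c0 : cofactor M 0 0 = M 1 1.
    rewrite /cofactor det_mx11 !mxE expr0 mul1r; congr (M _ _); exact: val_inj.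
  have c1 : cofactor M 0 1 = - M 1 0.
    rewrite /cofactor det_mx11 !mxE expr1 mulN1r; congr (- M _ _); exact: val_inj.
  rewrite (expand_det_row _ 0) big_ord_recl big_ord1 c0.
  by rewrite (_ : lift ord0 ord0 = 1) ?c1 ?mulrN//; apply: val_inj.
have E : null_rows = block_mx A 0 0 D :> 'M[R[i]]_(2 + 2).
  apply/matrixP => i j; rewrite !mxE.
  by case: splitP => -[[|[|//]] ?] ->; rewrite !mxE; case: splitP => -[[|[|//]] ?] ->;
    rewrite !mxE.
transitivity (\det (block_mx A 0 0 D)); first by rewrite -E.
rewrite det_ublock !det2 !mxE /=; ring.
Qed.

Lemma null_rows_cotetrad (B : 'M[R]_4) : 0 < \det B ->
  null_cotetrad (B^T *m minkowski *m B) (null_rows *m complexify B).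
Proof.
move=> dB; have E i a : (null_rows *m complexify B) i a =
    null_rows i i1 * (B i1 a)%:C + null_rows i i2 * (B i2 a)%:C +
    null_rows i i3 * (B i3 a)%:C + null_rows i i4 * (B i4 a)%:C.
  by rewrite mxE sum4 !mxE.
have ii : 'i%C * 'i%C = -1 :> R[i] by rewrite -expr2 sqr_i.
split=> [a|a|a b|].
- rewrite !E !mxE /=; apply/eqP; rewrite eq_complex /=.
  by apply/andP; split; apply/eqP; ring.
- by rewrite !E !mxE /=; split; ring.
- rewrite !E mxE sum4 !mxE !sum4 !mxE /=.
  by apply/eqP; rewrite eq_complex /=; apply/andP; split; apply/eqP; field.
- rewrite det_mulmx det_null_rows det_map_mx mulrA.
  rewrite (_ : _ * (- 4 * 'i%C) = 4); last first.
    by transitivity (- 4 * ('i%C * 'i%C) : R[i]); [ring|rewrite ii; ring].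
  by rewrite mulr_gt0// ltcR.
Qed.

(** The orthonormal components of [l] at [z = s + i t], obtained by solving [M = -z], [N = z z^*],
    [K = 1] in the cotetrad [null_rows]. *)
Definition null_vector (s t : R) (i : 'I_4) : R :=
  nth 0 [:: - s; - t; (s ^+ 2 + t ^+ 2 - 1) / 2; (s ^+ 2 + t ^+ 2 + 1) / 2] i.

Lemma null_cone_form (S : 'M[R]_4) : S^T = S ->
  (forall s t, \sum_i \sum_j null_vector s t i * S i j * null_vector s t j = 0) ->
  S = (- S i4 i4) *: minkowski.
Proof.
move=> /matrixP symS S0.
have sy i j : S i j = S j i by rewrite -[in LHS]symS mxE.
have E s t : let u := null_vector s t in
  S i1 i1 * (u i1 * u i1) + S i2 i2 * (u i2 * u i2) + S i3 i3 * (u i3 * u i3) +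
  S i4 i4 * (u i4 * u i4) + S i1 i2 * (2 * u i1 * u i2) + S i1 i3 * (2 * u i1 * u i3) +
  S i1 i4 * (2 * u i1 * u i4) + S i2 i3 * (2 * u i2 * u i3) +
  S i2 i4 * (2 * u i2 * u i4) + S i3 i4 * (2 * u i3 * u i4) = 0.
  rewrite /= -[RHS](S0 s t) sum4 !sum4 (sy i2 i1) (sy i3 i1) (sy i4 i1) (sy i3 i2).
  by rewrite (sy i4 i2) (sy i4 i3); ring.
(* On each axis the form is a quartic in one variable, hence settled by the five values at 0, 1, -1,
   2, -2; the point (1, 1) then isolates [S i1 i2]. *)
have := (E 0 0, E 1 0, E (-1) 0, E 0 1, E 0 (-1), E 2 0, E (-2) 0, E 0 2, E 0 (-2), E 1 1).
rewrite /null_vector /= => -[[[[[[[[[]]]]]]]]] e0 e1 e2 e3 e4 e5 e6 e7 e8 e9.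
have [] : [/\ S i1 i2 = 0, S i1 i3 = 0, S i1 i4 = 0, S i2 i3 = 0 & S i2 i4 = 0] /\
   [/\ S i3 i4 = 0, S i1 i1 = - S i4 i4, S i2 i2 = - S i4 i4 & S i3 i3 = - S i4 i4].
  by split; split; lra.
move=> [h12 h13 h14 h23 h24] [h34 h11 h22 h33].
apply/matrixP => i j; rewrite !mxE.
move: i j; apply: ord4_ind; apply: ord4_ind; rewrite /= ?(sy i2 i1) ?(sy i3 i1)
  ?(sy i4 i1) ?(sy i3 i2) ?(sy i4 i2) ?(sy i4 i3)
  ?h12 ?h13 ?h14 ?h23 ?h24 ?h34 ?h11 ?h22 ?h33 ?mulr0 ?mulr1n ?mulr0n ?mulr1 ?mulrN1 ?opprK //.
Qed.

End LorentzAlgebra.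

(** * The Einstein-Weyl equations *)

Section EinsteinWeyl.
Context {R : realType}.

Lemma twistor_planeP (T : 'M[R[i]]_4) z (u : 'rV[R[i]]_4) : T \in unitmx ->
  (u \in twistor_plane T (Some z)) <->
  exists k l, frame_coord T u =1 (fun i => nth 0 [:: k * z; - l; l * z; - k] i).
Proof.
move=> uT; pose e j := (col j (invmx T))^T.
have Ee k i : frame_coord T (e k) i = (i == k)%:R.
  have /matrixP/(_ i k) := mulmxV uT; rewrite [RHS]mxE mxE => <-.
  by rewrite /frame_coord /e trmxK mxE; apply: eq_bigr => a _; rewrite mxE.
have Ep k l : frame_coord T (k *: (z *: e i1 + (-1) *: e i4) + l *: (z *: e i3 + (-1) *: e i2))
    =1 (fun i => nth 0 [:: k * z; - l; l * z; - k] i).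
  move: (e) Ee => f Ef i.
  rewrite (frame_coord_lin T k l) (frame_coord_lin T z (-1) (f i1)).
  rewrite (frame_coord_lin T z (-1) (f i3)) (Ef i1) (Ef i4) (Ef i3) (Ef i2).
  by move: i; apply: ord4_ind => /=; ring.
have -> : twistor_plane T (Some z) =
    (<[z *: e i1 + (-1) *: e i4]> + <[z *: e i3 + (-1) *: e i2]>)%VS.
  by rewrite /twistor_plane span_cons span_seq1 !scaleN1r.
split=> [/memv_addP[v /vlineP[k ->] [w /vlineP[l ->] ->]]|[k [l E]]].
  by exists k, l; exact: Ep.
have -> : u = k *: (z *: e i1 + (-1) *: e i4) + l *: (z *: e i3 + (-1) *: e i2).
  by apply: (frame_coord_inj uT) => i; rewrite E Ep.
by apply: memv_add; apply/vlineP; [exists k|exists l].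
Qed.

(** The real vectors of a twistor plane form a single null line. The plane alone fixes it, so it can
    be compared between two cotetrads presenting the same plane. *)
Lemma real_in_twistor_plane (G : 'M[R]_4) (T : 'M[R[i]]_4) z (u : 'rV[R]_4) :
  null_cotetrad G T -> T \in unitmx -> complexify u \in twistor_plane T (Some z) ->
  exists k, frame_coord T (complexify u) =1 (fun i => k * null_coord z i).
Proof.
move=> nT uT /(twistor_planeP _ _ uT)[k [l E]]; exists (- k).
have cu i : frame_coord T (complexify u) i =
    conjc (frame_coord T (complexify u) (conj_label i)).
  by rewrite -(frame_coord_conj _ _ nT) (realmx_complexify u).
have := cu i2; rewrite !E /= => l1.
have := cu i4; rewrite !E /= => k1.
have k2 : conjc k = k by apply: oppr_inj; rewrite k1; exact: esym (rmorphN _ _).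
have l2 : l = - (k * conjc z).
  by apply: oppr_inj; rewrite l1 opprK -{2}k2; exact: rmorphM.
move=> i; rewrite E l2 /null_coord; move: i; apply: ord4_ind => /=; ring.
Qed.

Lemma real_complexify m n (M : 'M[R[i]]_(m, n)) : is_realmx M ->
  M = complexify (map_mx (@complex.Re R) M).
Proof.
move=> /matrixP rM; apply/matrixP => i j; rewrite !mxE.
have := rM i j; rewrite mxE; case: (M i j) => p q /= [] /eqP.
by rewrite eq_sym -addr_eq0 -mulr2n mulrn_eq0 => /eqP ->.
Qed.

Lemma coord_ricci_real G A x : is_realmx (@coord_ricci R G A x).
Proof.
apply/matrixP => c b; rewrite !mxE rmorph_sum; apply: eq_bigr => a _ /=.
by have /matrixP/(_ a c) := coord_curvature_real G A a b x; rewrite mxE.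
Qed.

Lemma invariant_ricci (X : oriented_manifold4 R) (w : weyl_geometry X) c (x : X) :
  chart_dom c x ->
  (forall W, twistor_fiber (metric w c (chart c x)) W ->
    invariant_equation_at w c (chart c x) W) ->
  exists s, coord_ricci (metric w c) (weyl_form w c) (chart c x) +
    (coord_ricci (metric w c) (weyl_form w c) (chart c x))^T =
    s *: complexify (metric w c (chart c x)).
Proof.
move=> cx Hinv; set G := metric w c; set A := weyl_form w c; set y := chart c x.
have lG z : (chart c @` chart_dom c) z -> lorentzian (G z).
  by move=> [p cp <-]; exact: metric_lorentzian.
have [B dB GB] := lorentzian_det_gt0 (lG y (ex_intro2 _ _ x cx erefl)).
have uB : B \in unitmx by rewrite unitmxE unitfE gt_eqF.
pose T0 := null_rows *m complexify B.
have nT0 : null_cotetrad (G y) T0 by rewrite GB; exact: null_rows_cotetrad.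
have uT0 : T0 \in unitmx.
  by case: nT0 => _ _ _; rewrite unitmxE unitfE; apply: contraTneq => ->; rewrite mulr0 ltxx.
set Rc := coord_ricci G A y.
pose Rr := map_mx (@complex.Re R) Rc.
have RcE : Rc = complexify Rr by apply: real_complexify; exact: coord_ricci_real.
have quad (s t : R) (u : 'cV[R]_4) : B *m u = \col_i null_vector s t i ->
    (u^T *m Rr *m u) 0 0 = 0.
  move=> Bu; pose z : R[i] := s +i* t.
  have cu : frame_coord T0 (complexify u^T) =1 null_coord z.
    move=> i; rewrite /frame_coord /T0 -mulmxA.
    have -> : complexify B *m (complexify u^T)^T = complexify (\col_i null_vector s t i).
      by rewrite -Bu /complexify map_mxM; congr (_ *m _); apply/matrixP => k l; rewrite !mxE.
    rewrite mxE sum4 !mxE; move: i.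
    apply: ord4_ind; rewrite /null_coord /null_vector /=;
      apply/eqP; rewrite eq_complex /=; apply/andP; split; apply/eqP; by field.
  (* The cotetrad [T] and coordinate [z1] supplied here are tied to [T0] and [z] only through the
     plane they span. *)
  have [|U [T [Gam [z1 [[Uy UO] [cT nT] wT WE inv]]]]] := Hinv (twistor_plane T0 (Some z)).
    by exists T0, (Some z).
  have uT : T y \in unitmx by case: cT => _ _; apply.
  have sG q : U q -> mdiff (fun y => complexify (G y)) q.
    move=> Uq i j; under eq_fun do rewrite mxE.
    apply: (@csmooth_cdiff _ _ (chart c @` chart_dom c)); last exact: UO.
    apply: csmooth_real; apply: smooth_on_entry; first exact: chart_image_open.
    exact: metric_smooth.
  have symG q : U q -> (G q)^T = G q by move=> /UO/lG; exact: lorentzian_sym.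
  have unitG q : U q -> G q \in unitmx by move=> /UO/lG; exact: lorentzian_unit.
  have [X0 EX] : exists X0 : 'rV[R]_4, frame_coord (T y) (complexify X0) =1 null_coord z1.
    apply: (real_of_frame (nT y Uy) uT).
    apply: ord4_ind; rewrite /null_coord /=.
    - by rewrite conjcN.
    - by rewrite conjcN conjcK.
    - by rewrite conjcM conjcK mulrC.
    - exact: conjc1.
  have R0 := ricci_null cT wT nT sG symG unitG Uy inv EX.
  (* The coefficients come from [l = -(z m - k) + z^* (z n - p)]. *)
  have uW : complexify u^T \in twistor_plane (T y) (Some z1).
    rewrite -WE; apply/(twistor_planeP _ _ uT0); exists (-1), (conjc z) => i.
    by rewrite cu /null_coord; move: i; apply: ord4_ind => /=; ring.
  have [k Ek] := real_in_twistor_plane (nT y Uy) uT uW.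
  have uX : complexify u^T = k *: complexify X0.
    by apply: (frame_coord_inj uT) => i; rewrite frame_coordZ Ek EX.
  have : (complexify u^T *m Rc *m (complexify u^T)^T) 0 0 = 0.
    rewrite uX linearZ /= -!scalemxAl -scalemxAr scalerA mxE R0 mulr0 //.
  have -> : complexify u^T *m Rc *m (complexify u^T)^T = complexify (u^T *m Rr *m u).
    rewrite RcE /complexify !map_mxM; congr (_ *m _).
    by apply/matrixP => i j; rewrite !mxE.
  by rewrite mxE => /complexI.
pose Bi := invmx B.
(* The symmetrised Ricci tensor in the orthonormal frame given by [B], where the null cone takes its
   standard form. *)
pose S := Bi^T *m (Rr + Rr^T) *m Bi.
have symS : S^T = S.
  by rewrite /S !trmx_mul trmxK linearD /= trmxK [Rr^T + _]addrC mulmxA.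
have S0 s t : \sum_i \sum_j null_vector s t i * S i j * null_vector s t j = 0.
  pose v : 'cV[R]_4 := \col_i null_vector s t i.
  transitivity ((v^T *m S *m v) 0 0).
    rewrite mxE exchange_big; apply: eq_bigr => j _; rewrite mxE mulr_suml.
    by apply: eq_bigr => i _; rewrite !mxE.
  have q0 := quad s t (Bi *m v) (mulKVmx uB v).
  have -> : v^T *m S *m v = (Bi *m v)^T *m Rr *m (Bi *m v) +
      ((Bi *m v)^T *m Rr *m (Bi *m v))^T.
    rewrite /S !trmx_mul !trmxK mulmxDr mulmxDl mulmxDr mulmxDl !mulmxA //.
  by rewrite mxE [X in _ + X]mxE q0 addr0.
have := null_cone_form symS S0; move: (- S i4 i4) => r SE; exists r%:C.
have -> : Rc + Rc^T = complexify (Rr + Rr^T).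
  by rewrite RcE; apply/matrixP => i j; rewrite !mxE rmorphD.
have -> : Rr + Rr^T = B^T *m S *m B.
  rewrite /S !mulmxA -trmx_mul mulVmx// trmx1 mul1mx -mulmxA mulVmx// mulmx1 //.
rewrite SE -scalemxAr -scalemxAl -GB; apply/matrixP => i j.
by rewrite !mxE rmorphM.
Qed.

End EinsteinWeyl.

Theorem theorem7p5 (R : realType) (X : oriented_manifold4 R)
    (w : weyl_geometry X)
    (Hinv : forall (c : chart_index X) (x : X), chart_dom c x ->
      forall W : {vspace 'rV[R[i]]_4},
        twistor_fiber (metric w c (chart c x)) W ->
        invariant_equation_at w c (chart c x) W) :
  einstein_weyl w.
Proof.
move=> c U T Gam UO cT wT x Ux.
have lG y : U y -> lorentzian (metric w c y).
  by move=> /UO[p cp <-]; exact: metric_lorentzian.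
have sG q : U q -> mdiff (fun y => complexify (metric w c y)) q.
  move=> Uq i j; under eq_fun do rewrite mxE.
  apply: (@csmooth_cdiff _ _ (chart c @` chart_dom c)); last exact: UO.
  apply: csmooth_real; apply: smooth_on_entry; first exact: chart_image_open.
  exact: metric_smooth.
have [s Es] : exists s, coord_ricci (metric w c) (weyl_form w c) x +
    (coord_ricci (metric w c) (weyl_form w c) x)^T = s *: complexify (metric w c x).
  by have [p cp <-] := UO x Ux; apply: invariant_ricci => // W; exact: Hinv.
apply: (tracefree_ricci_eq0 cT wT sG _ _ Ux Es) => y /lG.
  exact: lorentzian_sym.
exact: lorentzian_unit.
Qed.
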